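(* Let $\sigma=(\sigma_{ij}):\mathbb{R}^d\to\mathbb{R}^{d\times d}$ and $b=(b_1,\dots,b_d):\mathbb{R}^d\to\mathbb{R}^d$ be Lipschitz continuous, let $f:[0,\infty)\times\mathbb{R}^d\to\mathbb{R}^d$ be a function, and for $x\in\mathbb{R}^d$ let $\{X^x_t\}_{t\ge 0}$ denote the solution of $$dX_t=\sigma(X_t)\,dB_t+b(X_t)\,dt,\quad t\ge 0,\qquad X_0=x.$$ Suppose that: (i) there exists an $x\in\mathbb{R}^d$ such that $\det(\sigma_{ij}(x))\neq 0$; (ii) $b_i\in C^2(\mathbb{R}^d,\mathbb{R})$ for $i=1,\dots,d$; (iii) for every fixed $x\in\mathbb{R}^d$, the map $t\in[0,\infty)\mapsto\frac{\partial f}{\partial t}(t,x)$ (exists and) is of bounded variation. Then the following are equivalent: (a) for every $x\in\mathbb{R}^d$, almost surely, $X^x_t=f(t,x)+X^0_t$ for all $t\ge 0$; (b) $\sigma$ is constant, equal to a real non-singular $d\times d$ matrix, and there exist $\alpha\in\mathbb{R}^d$ and a real $d\times d$ matrix $C$ such that $b(x)=\alpha+Cx$ for all $x\in\mathbb{R}^d$ and $f(t,x)=e^{tC}x$ for all $(t,x)\in[0,\infty)\times\mathbb{R}^d$.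
   Context: $(\Omega,\mathcal{F},(\mathcal{F}_t),P)$ is a filtered complete probability space satisfying the usual conditions, and $\{B_t\}$ is a standard $d$-dimensional $(\mathcal{F}_t)$ Brownian motion. Solutions are the (pathwise unique) strong solutions with continuous paths, which exist because $\sigma$ and $b$ are Lipschitz. When (a) holds for some function $f$, one says that the general solution of the diffusion depends deterministically on the initial condition (through $f$). ''Of bounded variation'' on $[0,\infty)$ is understood in the sense customary in stochastic calculus, i.e. of bounded variation on every compact interval $[0,T]$; derivatives in $t$ at $t=0$ are one-sided. *)

(* Defs.v *)
From HB Require Import structures.
From mathcomp Require Import all_boot all_order all_algebra.
From mathcomp Require Import all_classical all_reals all_analysis.
From mathcomp Require Import measurable_realfun.

Set Implicit Arguments.
Unset Strict Implicit.
Unset Printing Implicit Defensive.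

Import Order.TTheory GRing.Theory Num.Theory.
Import numFieldNormedType.Exports.

Local Open Scope classical_set_scope.
Local Open Scope ring_scope.

(* Time is [0, +oo[ inside R: a process is a function R -> Omega -> V of which
   only the values at nonnegative times are ever constrained. *)

Definition measurable_for (T : Type) (V : topologicalType)
    (G : set (set T)) (Y : T -> V) : Prop :=
  forall U : set V, <<s open >> U -> G (Y @^-1` U).

Definition filtration (disp : measure_display) (T : measurableType disp)
    (R : realType) (F : R -> set (set T)) : Prop :=
  [/\ forall t : R, 0 <= t -> sigma_algebra setT (F t),
      forall t : R, 0 <= t -> F t `<=` measurable
    & forall s t : R, 0 <= s -> s <= t -> F s `<=` F t].

Definition usual_conditions (disp : measure_display) (T : measurableType disp)
    (R : realType) (P : probability T R) (F : R -> set (set T)) : Prop :=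
  (forall N, P.-negligible N -> F 0 N) /\
  (forall t : R, 0 <= t -> F t = \bigcap_(s in `]t, +oo[) F s).

Definition adapted (T : Type) (R : realType) (V : topologicalType)
    (F : R -> set (set T)) (Y : R -> T -> V) : Prop :=
  forall t : R, 0 <= t -> measurable_for (F t) (Y t).

Definition continuous_paths (T : Type) (R : realType) (V : topologicalType)
    (Y : R -> T -> V) : Prop :=
  forall w, {within `[0, +oo[, continuous (fun t => Y t w)}.

(* [normal_prob m s] has standard deviation s; in the last clause the law
   N(0, (t - s) I_d) of an increment is given by its values on boxes. *)
Definition brownian_motion (disp : measure_display) (T : measurableType disp)
    (R : realType) (d : nat) (P : probability T R) (F : R -> set (set T))
    (B : R -> T -> 'cV[R]_d) : Prop :=
  [/\ adapted F B,
      continuous_paths B,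
      {ae P, forall w, B 0 w = 0},
      forall s t : R, 0 <= s -> s < t ->
        forall (A : set T) (U : set 'cV[R]_d), F s A -> <<s open >> U ->
        P (A `&` [set w | U (B t w - B s w)]) =
        (P A * P [set w | U (B t w - B s w)%R])%E
    & forall s t : R, 0 <= s -> s < t ->
        forall U : 'I_d -> set R, (forall i, measurable (U i)) ->
        P [set w | forall i, U i ((B t w - B s w) i 0)] =
        (\prod_(i < d) normal_prob 0 (Num.sqrt (t - s)) (U i))%E].

(* The process  sum_(k < size) coef_k 1_]time_k, time_{k+1}]  with bounded
   coef_k measurable at time_k. *)
Record simple_process (T : Type) (R : realType) (d : nat)
    (F : R -> set (set T)) := SimpleProcess {
  sp_size : nat;
  sp_time : nat -> R;
  sp_coef : nat -> T -> 'M[R]_d;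
  sp_time_ge0 : 0 <= sp_time 0%N;
  sp_time_nondecreasing : forall k, sp_time k <= sp_time k.+1;
  sp_coef_measurable : forall k, measurable_for (F (sp_time k)) (sp_coef k);
  sp_coef_bounded : forall k, exists M, forall w, `|sp_coef k w| <= M }.

Definition simple_value (T : Type) (R : realType) (d : nat)
    (F : R -> set (set T)) (H : simple_process d F) (s : R) (w : T) : 'M[R]_d :=
  \sum_(k < sp_size H)
    (\1_(`]sp_time H k, sp_time H k.+1]) s : R) *: sp_coef H k w.

Definition simple_integral (T : Type) (R : realType) (d : nat)
    (F : R -> set (set T)) (B : R -> T -> 'cV[R]_d) (H : simple_process d F)
    (t : R) (w : T) : 'cV[R]_d :=
  \sum_(k < sp_size H)
    sp_coef H k w *m (B (Num.min (sp_time H k.+1) t) w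
                      - B (Num.min (sp_time H k) t) w).

Definition cvg_proba0 (disp : measure_display) (T : measurableType disp)
    (R : realType) (P : probability T R) (Z : nat -> T -> \bar R) : Prop :=
  (forall n, measurable_fun [set: T] (Z n)) /\
  (forall e : R, 0 < e ->
    P [set w | (e%:E <= Z n w)%E] @[n --> \oo] --> 0%E).

(* I is (the continuous version of) the Ito integral of H against B: the
   extension of the integral of simple processes to integrands with locally
   square integrable paths. For H with measurable paths the approximation clause
   forces int_0^t |H|^2 ds < +oo almost surely, so this is not assumed
   separately. *)
Definition ito_integral (disp : measure_display) (T : measurableType disp)
    (R : realType) (d : nat) (P : probability T R) (F : R -> set (set T))
    (B : R -> T -> 'cV[R]_d) (H : R -> T -> 'M[R]_d) (I : R -> T -> 'cV[R]_d)
    : Prop :=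
  [/\ adapted F I, continuous_paths I
    & exists Hn : nat -> simple_process d F, forall t : R, 0 <= t ->
        cvg_proba0 P (fun n w =>
          (\int[lebesgue_measure]_(s in `[0%R, t])
            ((`|simple_value (Hn n) s w - H s w| ^+ 2)%R)%:E)%E) /\
        cvg_proba0 P (fun n w =>
          `|simple_integral B (Hn n) t w - I t w|%:E)].

Definition drift_integral (T : Type) (R : realType) (d : nat)
    (b : 'cV[R]_d -> 'cV[R]_d) (X : R -> T -> 'cV[R]_d) (t : R) (w : T)
    : 'cV[R]_d :=
  \col_i (\int[lebesgue_measure]_(s in `[0%R, t]) (b (X s w) i 0)).

Definition strong_solution (disp : measure_display) (T : measurableType disp)
    (R : realType) (d : nat) (P : probability T R) (F : R -> set (set T))
    (B : R -> T -> 'cV[R]_d) (sigma : 'cV[R]_d -> 'M[R]_d)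
    (b : 'cV[R]_d -> 'cV[R]_d) (x : 'cV[R]_d) (X : R -> T -> 'cV[R]_d) : Prop :=
  [/\ adapted F X, continuous_paths X, {ae P, forall w, X 0 w = x}
    & exists2 I, ito_integral P F B (fun s w => sigma (X s w)) I
        & {ae P, forall w, forall t : R, 0 <= t ->
             X t w = x + I t w + drift_integral b X t w}].

Fixpoint class_C (R : realType) (d k : nat) (g : 'cV[R]_d -> R) : Prop :=
  continuous g /\
  if k is k'.+1 then
    forall j : 'I_d, (forall x, derivable g x (delta_mx j 0)) /\
                     class_C k' (fun x => 'D_(delta_mx j 0) g x)
  else True.

(* Derivative at t of a function on [0, +oo[, one-sided at t = 0. *)
Definition is_time_derivative (R : realType) (d : nat) (g : R -> 'cV[R]_d)
    (t : R) (v : 'cV[R]_d) : Prop :=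
  h^-1 *: (g (t + h) - g t) @[h --> within [set h | 0 <= t + h] 0^'] --> v.

Definition locally_bounded_variation (R : realType) (d : nat)
    (g : R -> 'cV[R]_d) : Prop :=
  forall (a : R) (i : 'I_d), 0 < a -> bounded_variation 0 a (fun t => g t i 0).

Definition expmx (R : realType) (d : nat) (A : 'M[R]_d) : 'M[R]_d :=
  limn (series (fun k => (k`!%:R)^-1 *: A ^+ k)).

(* Main.v *)
(* Near time 0 a solution satisfies X^x_t = x + sigma(x) B_t + o(sqrt t) in probability: the
   stochastic integral of an integrand close to M on [0, t] is close to M B_t, by the L^2
   isometry for stopped simple integrands. If X^x_t - X^0_t is deterministic, then so is
   (sigma(x) - sigma(0)) B_t up to o(sqrt t), and since B_t / sqrt t has a fixed nondegenerate
   law this forces sigma(x) = sigma(0). With sigma = S constant the stochastic integrals of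
   both solutions equal S B_t, so f(t, x) - x is the integral of b(X^x) - b(X^0), and
   differentiating in t makes b(X^x_t) - b(X^0_t) deterministic. Its first-order expansion at
   t = 0 is (grad b(x) - grad b(0)) S B_t + o(sqrt t) up to a constant, so the same argument
   gives grad b(x) = grad b(0) and b is affine. Then X^x - X^0 solves y' = C y with
   y(0) = x, whose solution is e^(tC) x; this last step also gives the converse. *)

Require Import Defs.
From HB Require Import structures.
From mathcomp Require Import all_boot all_order all_algebra.
From mathcomp Require Import all_classical all_reals all_analysis.
From mathcomp Require Import measurable_realfun.
From mathcomp Require Import ring lra.
Set Implicit Arguments.
Unset Strict Implicit.
Unset Printing Implicit Defensive.
Import Order.TTheory GRing.Theory Num.Theory.
Import numFieldNormedType.Exports.
Local Open Scope classical_set_scope.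
Local Open Scope ring_scope.

(** * Independence and Gaussian moments *)

(** [ito_integral] is known only through simple integrals that converge in probability, so every
    estimate bounds the probability of a bad event; L^2 arguments are applied only to finite sums
    with bounded coefficients, cut off once their accumulated variance is too large. The scale that
    decides is sqrt t: the Brownian part has exactly this order, the drift is O(t), and replacing
    sigma(X_s) by sigma(x) costs a small multiple of sqrt t off an event of small probability,
    because the path stays near x for a short time. Only orders of magnitude count at this scale, so
    Gaussian second moments enter as 8 s^2, a bound obtained by comparing densities. Nondegeneracy
    is the opposite estimate: the probability that B_t / sqrt t lies in a given box is bounded below
    uniformly in t, so an exceptional event of smaller probability leaves sample points in boxes on
    either side of 0. Deterministic functions are read off at a single good sample point. The same
    device supplies solutions of y' = C y from every basis vector, and with them the convergence of
    the exponential series. *)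

Definition independent_pair (disp : measure_display) (T : measurableType disp)
    (R : realType) (P : probability T R) (Y Z : T -> R) : Prop :=
  forall U V : set R, measurable U -> measurable V ->
    P (Y @^-1` U `&` Z @^-1` V) = (P (Y @^-1` U) * P (Z @^-1` V))%E.

Section independence.
Context (disp : measure_display) (T : measurableType disp) (R : realType)
  (P : probability T R).
Implicit Types Y Z : T -> R.

(** Independence says that the law of (Y, Z) agrees with the product of the marginal laws on
    rectangles, hence everywhere. Tonelli for |y z| gives integrability, then Fubini factors the
    expectation. *)
Lemma independent_expectationM Y Z :
  P.-integrable setT (EFin \o Y) -> P.-integrable setT (EFin \o Z) ->
  independent_pair P Y Z ->
  P.-integrable setT (EFin \o (Y \* Z)%R) /\
  (\int[P]_w (Y w * Z w)%:E = \int[P]_w (Y w)%:E * \int[P]_w (Z w)%:E)%E.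
Proof.
move=> iY iZ YZ.
have mY : measurable_fun setT Y by apply/measurable_EFinP; exact: measurable_int iY.
have mZ : measurable_fun setT Z by apply/measurable_EFinP; exact: measurable_int iZ.
pose Ym : {mfun T >-> R} := HB.pack Y (isMeasurableFun.Build _ _ _ _ _ mY).
pose Zm : {mfun T >-> R} := HB.pack Z (isMeasurableFun.Build _ _ _ _ _ mZ).
pose YZp : T -> R * R := fun w => (Y w, Z w).
have mYZp : measurable_fun setT YZp by exact: measurable_fun_pair.
pose YZm : {mfun T >-> (R * R)%type} :=
  HB.pack YZp (isMeasurableFun.Build _ _ _ _ _ mYZp).
pose mu1 := distribution P Ym.
pose mu2 := distribution P Zm.
have jointE : forall X : set (R * R), measurable X ->
    (mu1 \x mu2)%E X = distribution P YZm X.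
  apply: product_measure_unique => A C mA mC.
  by rewrite /distribution /pushforward /= -YZ.
pose f := fun z : R * R => (z.1 * z.2)%:E.
have mf : measurable_fun setT f.
  by apply/measurable_EFinP; apply: measurable_funM; [exact: measurable_fst|exact: measurable_snd].
have int1 (g : R -> R) : measurable_fun setT g -> (forall x, 0 <= g x) ->
  (\int[mu1]_y (g y)%:E = \int[P]_w (g (Y w))%:E)%E.
  move=> mg g0; rewrite /mu1 ge0_integral_distribution //.
  exact/measurable_EFinP.
have i2 : (\int[mu2]_y (`|y|)%:E = \int[P]_w (`|Z w|)%:E)%E.
  by rewrite /mu2 ge0_integral_distribution //; exact/measurable_EFinP.
have i1 : (\int[mu1]_y (`|y|)%:E = \int[P]_w (`|Y w|)%:E)%E by apply: int1.
have intf : (mu1 \x mu2)%E.-integrable setT f.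
  apply/integrable12ltyP => //.
  have mnorm : measurable_fun setT (fun y : R => `|y|%:E).
    by apply/measurable_EFinP.
  have E x : (\int[mu2]_y `|f (x, y)| = `|x|%:E * \int[P]_w (`|Z w|)%:E)%E.
    by rewrite -i2 -ge0_integralZl//; apply: eq_integral => y _; rewrite /f /= normrM EFinM.
  rewrite (eq_integral _ _ (fun x _ => E x)) ge0_integralZr//; last exact: integral_ge0.
  rewrite i1.
  move/integrableP : iY => [_ iY]; move/integrableP : iZ => [_ iZ].
  by apply: lte_mul_pinfty => //; rewrite ?ge0_fin_numE //; apply: integral_ge0.
have intD : (distribution P YZm).-integrable setT f.
  move/integrableP : intf => [_ intf].
  apply/integrableP; split=> //.
  rewrite -(@eq_measure_integral _ _ _ _ (distribution P YZm) (mu1 \x mu2)%E) //.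
  by move=> A mA _; exact: jointE.
have intYZ : P.-integrable setT (EFin \o (Y \* Z)%R).
  move/integrableP : intD => [_ intD].
  apply/integrableP; split; first by apply/measurable_EFinP; exact: measurable_funM.
  rewrite ge0_integral_distribution // in intD.
  exact: measurableT_comp.
split => //.
transitivity (\int[distribution P YZm]_z f z)%E.
  by rewrite integral_distribution.
transitivity (\int[(mu1 \x mu2)%E]_z f z)%E.
  by apply: eq_measure_integral => A mA _; exact/esym/jointE.
rewrite -integral12_prod_meas1// /fubini_F.
have iZ2 : mu2.-integrable setT (fun y : R => y%:E).
  apply/integrableP; split; first by apply/measurable_EFinP.
  by rewrite i2; case/integrableP : iZ.
have iY1 : mu1.-integrable setT (fun y : R => y%:E).
  apply/integrableP; split; first by apply/measurable_EFinP.
  by rewrite i1; case/integrableP : iY.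
have E2 : (\int[mu2]_y y%:E = \int[P]_w (Z w)%:E)%E.
  by rewrite /mu2 integral_distribution.
have E1 : (\int[mu1]_y y%:E = \int[P]_w (Y w)%:E)%E.
  by rewrite /mu1 integral_distribution.
have E x : (\int[mu2]_y f (x, y) = x%:E * \int[P]_w (Z w)%:E)%E.
  by rewrite -E2 -integralZl.
rewrite (eq_integral _ _ (fun x _ => E x)).
have fZ : (\int[P]_w (Z w)%:E)%E \is a fin_num by exact: integrable_fin_num.
by rewrite /= -(fineK fZ) integralZr// E1.
Qed.

End independence.

Section normal_moments.
Context (R : realType).
Local Notation mu := (@lebesgue_measure R).

(** The change of variables is available for the Radon-Nikodym derivative, which equals the Gaussian
    density almost everywhere because both have the same integral over every measurable set. *)
Lemma ge0_integral_normal_prob (s : R) (g : R -> R) :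
  measurable_fun setT g -> (forall x, 0 <= g x) ->
  (\int[normal_prob 0 s]_x (g x)%:E =
   \int[mu]_x (g x * normal_pdf 0 s x)%:E)%E.
Proof.
move=> mg g0.
have dom := normal_prob_dominates (0 : R) s.
rewrite -(Radon_Nikodym_SigmaFinite.change_of_variables dom) //; last first.
  exact/measurable_EFinP.
apply: ae_eq_integral => //.
- apply: emeasurable_funM => //; first exact/measurable_EFinP.
  exact: measurable_int (Radon_Nikodym_SigmaFinite.f_integrable dom).
- apply/measurable_EFinP; apply: measurable_funM => //.
  exact: measurable_normal_pdf.
- suff : ae_eq mu setT (Radon_Nikodym_SigmaFinite.f (normal_prob 0 s) mu)
      (fun x => (normal_pdf 0 s x)%:E).
    by apply: filterS => x /= H /H ->; rewrite EFinM.
  apply: integral_ae_eq => //=.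
  + exact: (Radon_Nikodym_SigmaFinite.f_integrable dom).
  + by apply/measurable_EFinP; exact: measurable_normal_pdf.
  + by move=> E _ mE; rewrite -Radon_Nikodym_SigmaFinite.f_integral.
Qed.

Lemma normal_probN (s : R) (U : set R) : s != 0 -> measurable U ->
  normal_prob 0 s (-%R @^-1` U) = normal_prob 0 s U.
Proof.
move=> s0 mU; rewrite /normal_prob.
have mN : measurable_fun setT (-%R : measurableTypeR R -> measurableTypeR R).
  exact: oppr_measurable.
have mU' : measurable (U : set (measurableTypeR R)) := mU.
have E x : normal_pdf 0 s x = normal_pdf 0 s (- x).
  by rewrite !normal_pdfE // /normal_fun !subr0 sqrrN.
transitivity (\int[pushforward mu (-%R : measurableTypeR R -> measurableTypeR R)]_(x in U) (normal_pdf 0 s x)%:E)%E.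
  have mpdf : measurable_fun (U : set (measurableTypeR R)) (fun x => (normal_pdf 0 s x)%:E).
    by apply/measurable_EFinP/measurable_funTS; exact: measurable_normal_pdf.
  rewrite (ge0_integral_pushforward mN mu mU' mpdf); last first.
    by move=> x _; rewrite lee_fin normal_pdf_ge0.
  by apply: eq_integral => x _ /=; rewrite -E.
by apply: eq_measure_integral => A mA _; exact: lebesgue_measureN.
Qed.

(* x^2 e^(-x^2/4s^2) is bounded, so x^2 times a Gaussian is dominated by a wider Gaussian. *)
Lemma sqr_normal_pdf_le (s x : R) : 0 < s ->
  x ^+ 2 * normal_pdf 0 s x <= 8 * s ^+ 2 * normal_pdf 0 (Num.sqrt 2 * s) x.
Proof.
move=> s0; have s20 : 0 < Num.sqrt 2 * s by rewrite mulr_gt0 ?sqrtr_gt0.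
rewrite !normal_pdfE ?gt_eqF // /normal_fun subr0 !exprMn sqr_sqrtr //.
have pk : normal_peak s <= 2 * normal_peak (Num.sqrt 2 * s).
  rewrite /normal_peak ler_pdivlMr; last first.
    by rewrite sqrtr_gt0 mulrn_wgt0 // mulr_gt0 ?exprn_gt0 ?pi_gt0.
  rewrite mulrC ler_pdivrMr; last first.
    by rewrite sqrtr_gt0 mulrn_wgt0 // mulr_gt0 ?exprn_gt0 ?pi_gt0.
  rewrite exprMn sqr_sqrtr //.
  have q0 : 0 <= s ^+ 2 * pi by rewrite mulr_ge0 ?pi_ge0 ?sqr_ge0.
  rewrite -[2 * s ^+ 2 * pi]mulrA.
  move: (s ^+ 2 * pi) q0 => q q0.
  have -> : 2 * Num.sqrt (q *+ 2) = Num.sqrt (4 * (q *+ 2)).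
    have -> : (4 : R) = 2 ^+ 2 by rewrite expr2 -natrM.
    by rewrite sqrtrM ?sqr_ge0 // sqrtr_sqr ger0_norm.
  by rewrite ler_sqrt; lra.
(* The constant 8 is a product of three factors 2: from x^2 = 2 u s^2, from the peaks (whose exact
   ratio is sqrt 2), and from u e^(-u/2) <= 2, a consequence of 1 + u/2 <= e^(u/2). The other half
   of e^(-u) is the exponential of the wider density. *)
set u := x ^+ 2 / (s ^+ 2 *+ 2).
have ss : 0 < s ^+ 2 by rewrite exprn_gt0.
have xE : x ^+ 2 = u * s ^+ 2 *+ 2.
  rewrite /u -[s ^+ 2 *+ 2]mulr_natr -[RHS]mulr_natr; field; rewrite gt_eqF //.
have -> : - x ^+ 2 / (s ^+ 2 *+ 2) = - u by rewrite mulNr.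
have -> : - x ^+ 2 / (2 * s ^+ 2 *+ 2) = - (u / 2).
  by rewrite /u mulNr -[s ^+ 2 *+ 2]mulr_natr -[2 * s ^+ 2 *+ 2]mulr_natr; congr (- _); field; rewrite gt_eqF.
have ue : u * expR (- (u / 2)) <= 2.
  have := expR_ge1Dx (u / 2).
  have : expR (u/2) * expR (- (u / 2)) = 1 by rewrite expRxMexpNx_1.
  have := expR_gt0 (- (u/2)).
  move: (expR _) (expR _) => e1 e2 e20 e12 ue1.
  have := ler_wpM2r (ltW e20) ue1; rewrite e12 (_ : (1 + u / 2) * e2 = e2 + (u * e2) / 2); last by clearbody u; field.
  move: (u * e2) => ?; lra.
have -> : expR (- u) = expR (- (u / 2)) * expR (- (u / 2)) by rewrite -expRD; congr expR; clearbody u; lra.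
have := expR_gt0 (- (u/2)).
move: (expR _) ue => e ue e0.
rewrite xE.
have p0 : 0 <= normal_peak s by exact: normal_peak_ge0.
have A : normal_peak s * (u * e) <= 2 * normal_peak (Num.sqrt 2 * s) * 2.
  apply: (@le_trans _ _ (normal_peak s * 2)); first exact: ler_wpM2l.
  by rewrite ler_wpM2r.
have -> : u * s ^+ 2 *+ 2 * (normal_peak s * (e * e)) = (normal_peak s * (u * e)) * (2 * s ^+2 * e) by rewrite -[_ *+ 2]mulr_natr; ring.
have -> : 8 * s ^+ 2 * (normal_peak (Num.sqrt 2 * s) * e) = 2 * normal_peak (Num.sqrt 2 * s) * 2 * (2 * s ^+ 2 * e) by ring.
by apply: ler_wpM2r => //; rewrite !mulr_ge0 // ltW.
Qed.

(** Every x in [a, b] satisfies |x| <= |a| + |b|, so the density is at least its value at |a| +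
    |b|. *)
Lemma normal_prob_interval_ge (s a b : R) : 0 < s -> a < b ->
  ((normal_peak s * expR (- (`|a| + `|b|) ^+ 2 / (s ^+ 2 *+ 2)) * (b - a))%:E
   <= normal_prob 0 s `[a, b]%classic)%E.
Proof.
move=> s0 ab; rewrite /normal_prob.
have c0 : 0 <= normal_peak s * expR (- (`|a| + `|b|) ^+ 2 / (s ^+ 2 *+ 2)).
  by rewrite mulr_ge0 ?normal_peak_ge0 ?expR_ge0.
apply: (@le_trans _ _ (\int[mu]_(x in `[a, b]%classic) (normal_peak s * expR (- (`|a| + `|b|) ^+ 2 / (s ^+ 2 *+ 2)))%:E)%E).
  by rewrite integral_cst //= lebesgue_measure_itv /= lte_fin ab -EFinD EFinM.
apply: ge0_le_integral => //.
- by apply/measurable_EFinP/measurable_funTS; exact: measurable_normal_pdf.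
- move=> x /=; rewrite in_itv /= => /andP[ax xb].
  rewrite lee_fin normal_pdfE ?gt_eqF // ler_wpM2l ?normal_peak_ge0 //.
  rewrite /normal_fun subr0 ler_expR ler_wpM2r ?invr_ge0 ?mulrn_wge0 ?sqr_ge0 // lerN2.
  rewrite -[leLHS]real_normK ?num_real // lerXn2r ?nnegrE ?addr_ge0 //.
  have := ler_norm b; have := ler_norm (- a); rewrite normrN.
  have := normr_ge0 a; have := normr_ge0 b.
  move: `|a| `|b| => a' b'.
  by have [x0|x0] := leP 0 x; rewrite ?(ger0_norm x0) ?(ltr0_norm x0); lra.
Qed.

End normal_moments.

Section normal_variable.
Context (disp : measure_display) (T : measurableType disp) (R : realType)
  (P : probability T R) (Z : T -> R) (s : R).
Hypotheses (s_gt0 : 0 < s) (mZ : measurable_fun setT Z)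
  (Z_normal : forall U : set R, measurable U -> P (Z @^-1` U) = normal_prob 0 s U).

Lemma ge0_integral_normal (g : R -> R) :
  measurable_fun setT g -> (forall x, 0 <= g x) ->
  (\int[P]_w (g (Z w))%:E = \int[normal_prob 0 s]_x (g x)%:E)%E.
Proof.
move=> mg g0.
pose Zm : {mfun T >-> measurableTypeR R} :=
  HB.pack (Z : T -> measurableTypeR R) (isMeasurableFun.Build _ _ _ (measurableTypeR R) _ mZ).
transitivity (\int[distribution P Zm]_x (g x)%:E)%E.
  by rewrite ge0_integral_distribution //; exact/measurable_EFinP.
apply: eq_measure_integral => A mA _.
exact: Z_normal.
Qed.

Lemma normal_sqr_expectation_le : (\int[P]_w (Z w ^+ 2)%:E <= (8 * s ^+ 2)%:E)%E.
Proof.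
rewrite (ge0_integral_normal (g := fun x => x ^+ 2)); last 2 first.
- exact: measurable_funX.
- by move=> x; exact: sqr_ge0.
rewrite ge0_integral_normal_prob; last 2 first.
- exact: measurable_funX.
- by move=> x; exact: sqr_ge0.
apply: (@le_trans _ _ (\int[lebesgue_measure]_x ((8 * s ^+ 2)%:E * (normal_pdf 0 (Num.sqrt 2 * s) x)%:E))%E).
  apply: ge0_le_integral => //.
  - by move=> x _; rewrite lee_fin mulr_ge0 ?sqr_ge0 ?normal_pdf_ge0.
  - by apply/measurable_EFinP; apply: measurable_funM; [exact: measurable_funX|exact: measurable_normal_pdf].
  - by apply/measurable_EFinP; apply: measurable_funM => //; exact: measurable_normal_pdf.
  - by move=> x _; rewrite lee_fin sqr_normal_pdf_le.
rewrite ge0_integralZl //.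
- by rewrite integral_normal_pdf mule1.
- by apply/measurable_EFinP; exact: measurable_normal_pdf.
- by move=> x _; rewrite lee_fin normal_pdf_ge0.
- by rewrite lee_fin mulr_ge0 ?sqr_ge0.
Qed.

Lemma normal_sqr_integrable : P.-integrable setT (fun w => (Z w ^+ 2)%:E).
Proof.
apply/integrableP; split; first by apply/measurable_EFinP; exact: measurable_funX.
under eq_integral do rewrite gee0_abs ?lee_fin ?sqr_ge0 //.
exact: le_lt_trans normal_sqr_expectation_le (ltry _).
Qed.

(** |z| <= 1 + z^2 makes the expectation finite, and it equals its own opposite because Z and -Z
    have the same law. *)
Lemma normal_expectation0 :
  P.-integrable setT (EFin \o Z) /\ (\int[P]_w (Z w)%:E = 0)%E.
Proof.
have iZ : P.-integrable setT (EFin \o Z).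
  apply: (@le_integrable _ _ _ _ _ measurableT _ (fun w => 1 + (Z w ^+ 2)%:E)%E).
  - exact/measurable_EFinP.
  - move=> w _; rewrite -EFinD /= lee_fin [leRHS]ger0_norm; last by rewrite addr_ge0 ?sqr_ge0.
    have := sqr_ge0 (`|Z w| - 1); rewrite sqrrB real_normK ?num_real // mulr1.
    have := normr_ge0 (Z w); lra.
  - apply: integrableD => //; last exact: normal_sqr_integrable.
    exact: finite_measure_integrable_cst.
split=> //.
have mN : measurable_fun setT (fun w => - Z w) by exact: measurableT_comp.
pose Zm : {mfun T >-> R} := HB.pack Z (isMeasurableFun.Build _ _ _ _ _ mZ).
pose Nm : {mfun T >-> R} := HB.pack (fun w => - Z w) (isMeasurableFun.Build _ _ _ _ _ mN).
have E : (\int[P]_w (Z w)%:E = \int[P]_w (- Z w)%:E)%E.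
  transitivity (\int[distribution P Zm]_x x%:E)%E.
    by rewrite integral_distribution.
  transitivity (\int[distribution P Nm]_x x%:E)%E; last first.
    rewrite integral_distribution //.
    by have /= := integrableN iZ.
  apply: eq_measure_integral => A mA _.
  transitivity (normal_prob 0 s A); first exact: Z_normal.
  rewrite -(normal_probN (lt0r_neq0 s_gt0)) //; apply/esym/Z_normal.
  by rewrite -[X in measurable X]setTI; exact: oppr_measurable.
have fZ : (\int[P]_w (Z w)%:E)%E \is a fin_num by exact: integrable_fin_num.
have EN : (\int[P]_w (- Z w)%:E = - \int[P]_w (Z w)%:E)%E.
  under eq_integral do rewrite EFinN.
  by rewrite integralN // fin_num_adde_defr // integrable_pos_fin_num.
move: E; rewrite EN -(fineK fZ) -EFinN => -[] E; congr EFin; lra.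
Qed.

End normal_variable.

(** * Tail bound for martingale transforms *)

Definition gmeasurable (T : Type) (R : realType) (G : set (set T)) (Y : T -> R) :=
  forall U : set R, measurable U -> G (Y @^-1` U).

Section gmeasurable.
Context (disp : measure_display) (T : measurableType disp) (R : realType).
Variable G : set (set T).
Hypothesis sG : sigma_algebra setT G.

(** A sigma-algebra is the one it generates, so [gmeasurable] is ordinary measurability on
    [g_sigma_algebraType G] and inherits its closure properties. *)
Lemma gmeasurableE (Y : T -> R) :
  gmeasurable G Y <-> measurable_fun setT (Y : g_sigma_algebraType G -> R).
Proof.
split=> [h _ U mU|h U mU].
- by rewrite setTI measurable_g_measurableTypeE //; exact: h.
- by have := h measurableT U mU; rewrite setTI measurable_g_measurableTypeE.
Qed.

Lemma gmeasurable_cst (c : R) : gmeasurable G (fun=> c).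
Proof. by apply/gmeasurableE; exact: measurable_cst. Qed.

Lemma gmeasurableD (Y Z : T -> R) : gmeasurable G Y -> gmeasurable G Z ->
  gmeasurable G (fun w => Y w + Z w).
Proof. by move=> /gmeasurableE hY /gmeasurableE hZ; apply/gmeasurableE; exact: measurable_funD. Qed.

Lemma gmeasurableM (Y Z : T -> R) : gmeasurable G Y -> gmeasurable G Z ->
  gmeasurable G (fun w => Y w * Z w).
Proof. by move=> /gmeasurableE hY /gmeasurableE hZ; apply/gmeasurableE; exact: measurable_funM. Qed.

Lemma gmeasurable_sum n (Y : nat -> T -> R) : (forall k, (k < n)%N -> gmeasurable G (Y k)) ->
  gmeasurable G (fun w => \sum_(k < n) Y k w).
Proof.
move=> h; apply/gmeasurableE.
apply: (eq_measurable_fun (\sum_(k < n) Y k : g_sigma_algebraType G -> R)).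
  by move=> w _; rewrite fct_sumE.
rewrite [X in measurable_fun _ X](_ : _ = (fun w => \sum_(k < n) Y k w)); last first.
  by apply/funext => w; rewrite fct_sumE.
by apply: measurable_sum => k; apply/gmeasurableE/h.
Qed.

Lemma gmeasurable_indic (A : set T) : G A -> gmeasurable G (\1_A : T -> R).
Proof.
move=> GA; apply/gmeasurableE; apply: measurable_indic.
by rewrite measurable_g_measurableTypeE.
Qed.

Lemma gmeasurable_measurable (Y : T -> R) : G `<=` measurable ->
  gmeasurable G Y -> measurable_fun setT Y.
Proof. by move=> Gm h _ U mU; rewrite setTI; exact/Gm/h. Qed.

End gmeasurable.

Lemma measurable_ge_level (disp : measure_display) (T : measurableType disp) (R : realType)
    (Y : T -> R) (c : R) : measurable_fun setT Y -> measurable [set w | c <= Y w].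
Proof.
move=> mY; have -> : [set w | c <= Y w] = Y @^-1` `[c, +oo[%classic.
  by apply/seteqP; split => w /=; rewrite in_itv /= andbT.
by rewrite -[X in measurable X]setTI; exact: mY.
Qed.

Lemma measurable_gt_level (disp : measure_display) (T : measurableType disp) (R : realType)
    (Y : T -> R) (c : R) : measurable_fun setT Y -> measurable [set w | c < Y w].
Proof.
move=> mY; have -> : [set w | c < Y w] = Y @^-1` `]c, +oo[%classic.
  by apply/seteqP; split => w /=; rewrite in_itv /= andbT.
by rewrite -[X in measurable X]setTI; exact: mY.
Qed.

Section martingale_transform.
Context (disp : measure_display) (T : measurableType disp) (R : realType)
  (P : probability T R).
Variables (G : nat -> set (set T)) (beta : nat -> T -> R) (v : nat -> R).
Hypotheses (sG : forall k, sigma_algebra setT (G k))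
  (Gm : forall k, G k `<=` measurable)
  (G_nondecreasing : forall k, G k `<=` G k.+1)
  (beta_measurable : forall k, gmeasurable (G k.+1) (beta k))
  (beta_indep : forall k A U, G k A -> measurable U ->
     P (A `&` beta k @^-1` U) = (P A * P (beta k @^-1` U))%E)
  (beta_integrable : forall k, P.-integrable setT (EFin \o beta k))
  (beta_centered : forall k, (\int[P]_w (beta k w)%:E = 0)%E)
  (beta_sqr : forall k, P.-integrable setT (fun w => (beta k w ^+ 2)%:E))
  (beta_var : forall k, (\int[P]_w (beta k w ^+ 2)%:E <= (v k)%:E)%E).

Let subG (j k : nat) : (j <= k)%N -> G j `<=` G k.
Proof.
move=> /subnK <-; elim: (k - j)%N => // n IH; rewrite addSn.
exact: subset_trans IH (@G_nondecreasing _).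
Qed.

Let transform (g : nat -> T -> R) (n : nat) (w : T) : R :=
  \sum_(k < n) g k w * beta k w.

Let v_ge0 k : 0 <= v k.
Proof.
rewrite -lee_fin; apply: le_trans (@beta_var k).
by apply: integral_ge0 => w _; rewrite lee_fin sqr_ge0.
Qed.

Let transform_gmeasurable (g : nat -> T -> R) n :
  (forall k, gmeasurable (G k) (g k)) -> gmeasurable (G n) (transform g n).
Proof.
move=> mg; apply: (@gmeasurable_sum _ _ _ _ (sG n) n (fun k w => g k w * beta k w)) => k kn; apply: gmeasurableM => //.
- by move=> U mU; exact/(subG (ltnW kn))/mg.
- by move=> U mU; exact/(subG kn)/beta_measurable.
Qed.

(** Orthogonality of martingale increments: the transform up to n times g_n is known at stage n,
    hence independent of the centered beta_n, and the cross term vanishes. The square term factors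
    for the same reason, and [v] bounds the variance of beta_n. *)
Lemma transform_second_moment (g : nat -> T -> R) n :
  (forall k, gmeasurable (G k) (g k)) ->
  (forall k, exists M, forall w, `|g k w| <= M) ->
  P.-integrable setT (fun w => (transform g n w ^+ 2)%:E) /\
  (\int[P]_w (transform g n w ^+ 2)%:E <=
   \int[P]_w (\sum_(k < n) g k w ^+ 2 * v k)%:E)%E.
Proof.
move=> mg bg.
have mg' k : measurable_fun setT (g k) by apply: (gmeasurable_measurable (@Gm _) (mg k)).
have mb k : measurable_fun setT (beta k).
  by apply/measurable_EFinP; exact: measurable_int (beta_integrable k).
elim: n => [|n [iW IH]].
  have -> : (fun w => (transform g 0 w ^+ 2)%:E) = cst 0%E.
    by apply/funext => w; rewrite /transform big_ord0 expr0n.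
  split; first exact: integrable0.
  rewrite integral0; apply: integral_ge0 => w _.
  by rewrite big_ord0.
have [M bM] := bg n.
have M0 : 0 <= M by apply: le_trans (bM point).
have GW : gmeasurable (G n) (transform g n) by exact: transform_gmeasurable.
have mW : measurable_fun setT (transform g n) by apply: (gmeasurable_measurable (@Gm _) GW).
have iY : P.-integrable setT (EFin \o (fun w => transform g n w * g n w)).
  apply: (@le_integrable _ _ _ _ _ measurableT _ (fun w => M%:E * (1 + (transform g n w ^+ 2)%:E))%E).
  - by apply/measurable_EFinP; exact: measurable_funM.
  - move=> w _ /=; rewrite lee_fin normrM [`|M * _|]normrM (ger0_norm M0) mulrC.
    apply: ler_pM => //.
    rewrite [leRHS]ger0_norm; last by rewrite addr_ge0 ?sqr_ge0.
    have := sqr_ge0 (`|transform g n w| - 1); rewrite sqrrB real_normK ?num_real // mulr1.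
    by have := normr_ge0 (transform g n w); lra.
  - apply: integrableZl => //; apply: integrableD => //.
    exact: finite_measure_integrable_cst.
have GY : gmeasurable (G n) (fun w => transform g n w * g n w) by exact: gmeasurableM.
have iYb : independent_pair P (fun w => transform g n w * g n w) (beta n).
  by move=> U V mU mV; apply: beta_indep => //; exact: GY.
have [icross Ecross] := independent_expectationM iY (beta_integrable n) iYb.
have ig2 : P.-integrable setT (EFin \o (fun w => g n w ^+ 2)).
  apply: (@le_integrable _ _ _ _ _ measurableT _ (fun w => (M ^+ 2)%:E)).
  - by apply/measurable_EFinP; exact: measurable_funX.
  - by move=> w _ /=; rewrite lee_fin normrX [leRHS]ger0_norm ?sqr_ge0 // lerXn2r ?nnegrE.
  - exact: finite_measure_integrable_cst.
have gG2 : gmeasurable (G n) (fun w => g n w ^+ 2).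
  by have := gmeasurableM (sG n) (mg n) (mg n).
have bG2 : independent_pair P (fun w => g n w ^+ 2) (fun w => beta n w ^+ 2).
  move=> U V mU mV.
  have -> : (fun w => beta n w ^+ 2) @^-1` V = beta n @^-1` ((fun x : R => x ^+ 2) @^-1` V) by [].
  apply: beta_indep; first exact: gG2.
  by rewrite -[X in measurable X]setTI; apply: measurable_funX.
have [isq Esq] := independent_expectationM ig2 (beta_sqr n) bG2.
have E w : (transform g n.+1 w ^+ 2)%:E =
   ((transform g n w ^+ 2)%:E + (2%:E * (transform g n w * g n w * beta n w)%:E
   + (g n w ^+ 2 * beta n w ^+ 2)%:E))%E.
  by rewrite /transform big_ord_recr /= -EFinM -!EFinD; congr EFin; ring.
have i2 : P.-integrable setT (fun w => 2%:E * (transform g n w * g n w * beta n w)%:E)%E.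
  exact: integrableZl.
have i3 : P.-integrable setT (fun w => (2%:E * (transform g n w * g n w * beta n w)%:E
   + (g n w ^+ 2 * beta n w ^+ 2)%:E))%E.
  exact: integrableD.
split.
  under eq_fun do rewrite E.
  exact: integrableD.
under eq_integral do rewrite E.
rewrite integralD // integralD // integralZl //.
rewrite [in X in (_ + (X + _) <= _)%E]Ecross beta_centered !mule0 add0e Esq.
under [leRHS]eq_integral do rewrite big_ord_recr /= EFinD.
have ms k : measurable_fun setT (fun w => g k w ^+ 2 * v k).
  by apply: measurable_funM => //; exact: measurable_funX.
rewrite ge0_integralD //=.
- apply: leeD => //.
  under [leRHS]eq_integral do rewrite EFinM.
  rewrite integralZr //.
  apply: lee_wpmul2l => //.
  by apply: integral_ge0 => w _; rewrite lee_fin sqr_ge0.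
- by move=> w _; rewrite lee_fin sumr_ge0 // => k _; rewrite mulr_ge0 ?sqr_ge0.
- apply/measurable_EFinP.
  by apply: measurable_sum.
- by move=> w _; rewrite lee_fin mulr_ge0 ?sqr_ge0.
- exact/measurable_EFinP.
Qed.

(* Stopping the coefficients when sum g_k^2 v_k exceeds delta leaves the transform unchanged
   outside the first event and makes its second moment at most delta. *)
Lemma transform_tail (g : nat -> T -> R) n (delta e : R) : 0 <= delta -> 0 < e ->
  (forall k, gmeasurable (G k) (g k)) ->
  (forall k, exists M, forall w, `|g k w| <= M) ->
  (P [set w | (e <= `|\sum_(k < n) g k w * beta k w|)%R] <=
   P [set w | (delta < \sum_(k < n) g k w ^+ 2 * v k)%R] + (delta / e ^+ 2)%:E)%E.
Proof.
move=> delta0 e0 mg bg.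
(* [Q k.+1] contains the term of index k and is still [G k]-measurable, since g_k is known before
   beta_k. The k-th term can therefore be dropped before the sum passes delta, and the stopped
   coefficients [h] stay adapted. *)
pose Q k w := \sum_(j < k) g j w ^+ 2 * v j.
pose A k := [set w | Q k.+1 w <= delta].
have mg' k : measurable_fun setT (g k) by apply: (gmeasurable_measurable (@Gm _) (mg k)).
have GQ k : gmeasurable (G k) (Q k.+1).
  apply: (@gmeasurable_sum _ _ _ _ (sG k) k.+1 (fun j w => g j w ^+ 2 * v j)) => j jk; apply: gmeasurableM => //; last exact: gmeasurable_cst.
  move=> U mU; have := gmeasurableM (sG j) (mg j) (mg j) mU; apply: subG; exact: jk.
have GA k : G k (A k).
  have -> : A k = Q k.+1 @^-1` `]-oo, delta]%classic.
    by apply/seteqP; split => w /=; rewrite in_itv.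
  exact: GQ.
pose h k w := g k w * \1_(A k) w.
have mh k : gmeasurable (G k) (h k).
  by apply: gmeasurableM => //; exact: gmeasurable_indic.
have bh k : exists M, forall w, `|h k w| <= M.
  have [M bM] := bg k; exists M => w; rewrite /h indicE.
  case: (w \in A k); rewrite ?mulr1 // mulr0 normr0.
  exact: le_trans (bM w).
(* If w is in [A m], the whole unstopped sum is at most delta; otherwise the last stopped term is 0
   and the induction hypothesis applies. *)
have hQ m w : \sum_(k < m) h k w ^+ 2 * v k <= delta.
  elim: m => [|m IH]; first by rewrite big_ord0.
  have [wA|wA] := boolP (w \in A m).
    have : Q m.+1 w <= delta by move: wA; rewrite inE.
    apply: le_trans; apply: ler_sum => k _; rewrite ler_wpM2r // /h.
    by rewrite exprMn ler_piMr ?sqr_ge0 // indicE; case: (_ \in _); rewrite ?expr1n ?expr0n.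
  by rewrite big_ord_recr /= {2}/h indicE (negbTE wA) mulr0 expr0n mul0r addr0.
have [iW EW] := transform_second_moment n mh bh.
have EW' : (\int[P]_w (transform h n w ^+ 2)%:E <= delta%:E)%E.
  apply: (le_trans EW).
  apply: (@le_trans _ _ (\int[P]_w (cst delta%:E) w)%E).
    apply: ge0_le_integral => //.
    - by move=> w _; rewrite lee_fin sumr_ge0 // => k _; rewrite mulr_ge0 ?sqr_ge0.
    - apply/measurable_EFinP; apply: measurable_sum => k; apply: measurable_funM => //.
      by apply: measurable_funX; apply: (gmeasurable_measurable (@Gm _) (mh k)).
    - by move=> w _; rewrite lee_fin.
  rewrite integral_cst //=. by have -> : P setT = 1%E; [exact: probability_setT|rewrite mule1].
have mW : measurable_fun setT (transform g n).
  by apply: (gmeasurable_measurable (@Gm n)); exact: transform_gmeasurable.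
have mWh : measurable_fun setT (transform h n).
  by apply: (gmeasurable_measurable (@Gm n)); exact: transform_gmeasurable.
have mQ : measurable_fun setT (Q n).
  apply: measurable_sum => k; apply: measurable_funM => //; exact: measurable_funX.
have mE1 : measurable [set w | delta < Q n w] by exact: measurable_gt_level.
have mnorm (Y : T -> R) : measurable_fun setT Y -> measurable [set w | e <= `|Y w|].
  by move=> mY; apply: measurable_ge_level; apply: measurableT_comp.
have hg w : Q n w <= delta -> transform h n w = transform g n w.
  move=> Qw; apply: eq_bigr => k _; congr (_ * _).
  have wA : A k w.
    rewrite /A /=; apply: le_trans Qw; rewrite /Q.
    rewrite -!(big_mkord xpredT (fun j => g j w ^+ 2 * v j)).
    rewrite (@big_cat_nat _ _ _ k.+1 0 n) //= ?lerDl ?sumr_ge0 // => j _.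
    by rewrite mulr_ge0 ?sqr_ge0.
  by rewrite /h indicE mem_set ?mulr1.
apply: (@le_trans _ _ (P ([set w | delta < Q n w] `|` [set w | e <= `|transform h n w|]))).
  apply: le_measure; rewrite ?inE; first exact: mnorm.
    by apply: measurableU => //; exact: mnorm.
  move=> w /= ew; have [Qw|Qw] := leP (Q n w) delta; [right|by left].
  by rewrite hg.
apply: le_trans (measureU2 _ _ _) _; rewrite //; first exact: mnorm.
apply: leeD => //.
(* What remains is Chebyshev's inequality for the stopped transform. *)
rewrite EFinM lee_pdivlMr ?exprn_gt0 //.
apply: le_trans EW'.
apply: (@le_trans _ _ (\int[P]_(w in [set w | (e <= `|transform h n w|)%R]) (e ^+ 2)%:E)%E).
  have mS := mnorm _ mWh.
  by rewrite integral_cst //= muleC.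
apply: (@le_trans _ _ (\int[P]_(w in [set w | (e <= `|transform h n w|)%R]) (transform h n w ^+ 2)%:E)%E).
  apply: ge0_le_integral => //.
  - exact: mnorm.
  - by move=> w _; rewrite lee_fin sqr_ge0.
  - by apply/measurable_EFinP/measurable_funTS/measurable_funX.
  - move=> w /= ew; rewrite lee_fin -[leRHS]real_normK ?num_real //.
    by rewrite lerXn2r ?nnegrE // ltW.
apply: ge0_subset_integral => //.
- exact: mnorm.
- by apply/measurable_EFinP/measurable_funX.
- by move=> w _; rewrite lee_fin sqr_ge0.
Qed.

End martingale_transform.

(** * Brownian increments and simple integrals *)

Lemma measurable_for_continuous (T : pointedType) (R : realType) m n (G : set (set T))
    (Y : T -> 'M[R]_(m, n)) (phi : 'M[R]_(m, n) -> R) :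
  measurable_for G Y -> continuous phi -> gmeasurable G (phi \o Y).
Proof.
move=> mY cphi U mU.
have mphi : measurable_fun setT (phi : g_sigma_algebraType (@open 'M[R]_(m, n)) -> R).
  apply: (measurability (@RGenOpens.G R)) => [|_ [_ [x [y ->]]] <-].
    exact: RGenOpens.measurableE.
  rewrite setTI; apply: sub_sigma_algebra.
  by move/continuousP : cphi; apply; exact: interval_open.
by rewrite comp_preimage; apply: mY; have := mphi measurableT U mU; rewrite setTI.
Qed.

Lemma measurable_forP (T : pointedType) (R : realType) m n (G : set (set T))
    (Y : T -> 'M[R]_(m, n)) i j :
  measurable_for G Y -> gmeasurable G (fun w => Y w i j).
Proof. by move=> mY; apply: (measurable_for_continuous mY (@coord_continuous _ _ _ i j)). Qed.

Lemma mx_coord_le (R : realType) m n (A : 'M[R]_(m, n)) i j : `|A i j| <= `|A|.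
Proof.
have -> : `|A| = mx_norm A by [].
rewrite mx_normrE.
by rewrite (bigD1 (i, j)) //= le_max lexx.
Qed.

Lemma mx_norm_le (R : realType) m n (A : 'M[R]_(m, n)) c : 0 <= c ->
  (forall i j, `|A i j| <= c) -> `|A| <= c.
Proof.
move=> c0 Ac; have -> : `|A| = mx_norm A by [].
by rewrite mx_normrE; apply: bigmax_le => // -[i j] _ /=.
Qed.

(** The norm is the largest absolute value of an entry, which is not submultiplicative: an entry of
    the product has n terms, hence the factor n. *)
Lemma mx_norm_mulmx (R : realType) m n p (A : 'M[R]_(m, n)) (B : 'M[R]_(n, p)) :
  `|A *m B| <= n%:R * `|A| * `|B|.
Proof.
apply: mx_norm_le => [|i k]; first by rewrite !mulr_ge0.
rewrite mxE (le_trans (ler_norm_sum _ _ _)) //.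
apply: (@le_trans _ _ (\sum_(j < n) `|A| * `|B|)).
  by apply: ler_sum => j _; rewrite normrM ler_pM // mx_coord_le.
by rewrite sumr_const card_ord -[leLHS]mulr_natl mulrA.
Qed.

Section brownian.
Context (R : realType) (d : nat) (disp : measure_display) (T : measurableType disp)
  (P : probability T R) (F : R -> set (set T)).
Hypothesis F_filtration : filtration F.
Variable B : R -> T -> 'cV[R]_d.
Hypothesis B_brownian : brownian_motion P F B.

Let sF t : 0 <= t -> sigma_algebra setT (F t).
Proof. by case: F_filtration => + _ _; apply. Qed.

Let Fm t : 0 <= t -> F t `<=` measurable.
Proof. by case: F_filtration => _ + _; apply. Qed.

Let Fle s t : 0 <= s -> s <= t -> F s `<=` F t.
Proof. by case: F_filtration => _ _; apply. Qed.

Lemma brownian_gmeasurable t (j : 'I_d) : 0 <= t -> gmeasurable (F t) (fun w => B t w j 0).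
Proof. by move=> t0; apply: measurable_forP; case: B_brownian => + _ _ _ _; apply. Qed.

Let incr (s t : R) (j : 'I_d) (w : T) : R := B t w j 0 - B s w j 0.

Lemma increment_gmeasurable s t j : 0 <= s -> s <= t -> gmeasurable (F t) (incr s t j).
Proof.
move=> s0 st; have t0 := le_trans s0 st.
have -> : incr s t j = (fun w => B t w j 0 + -1 * B s w j 0).
  by apply/funext => w; rewrite /incr mulN1r.
apply: (gmeasurableD (sF t0)); first exact: brownian_gmeasurable.
apply: (gmeasurableM (sF t0)); first exact: gmeasurable_cst (sF t0) _.
by move=> U mU; apply: (Fle s0 st); exact: brownian_gmeasurable.
Qed.

Lemma increment_measurable s t j : 0 <= s -> s <= t -> measurable_fun setT (incr s t j).
Proof.
move=> s0 st; apply: (gmeasurable_measurable (Fm (le_trans s0 st))).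
exact: increment_gmeasurable.
Qed.

(** Clipped grids repeat times, so s = t must be covered: the increment is then 0 and its events are
    empty or full. *)
Lemma increment_independent s t j A (U : set R) : 0 <= s -> s <= t -> F s A -> measurable U ->
  P (A `&` incr s t j @^-1` U) = (P A * P (incr s t j @^-1` U))%E.
Proof.
move=> s0; rewrite le_eqVlt => /orP[/eqP <-|st] FA mU.
  have -> : incr s s j @^-1` U = [set _ | U 0].
    by apply/seteqP; split => w; rewrite /incr /= subrr.
  have [U0|U0] := pselect (U 0).
    have -> : [set _ : T | U 0] = setT by apply/seteqP; split.
    by rewrite setIT [P setT](_ : _ = 1%E) ?mule1 //; exact: probability_setT.
  have -> : [set _ : T | U 0] = set0 by apply/seteqP; split.
  by rewrite setI0 measure0 mule0.
have [_ _ _ + _] := B_brownian => /(_ s t s0 st A (fun v => U (v j 0)) FA).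
have -> : [set w | U ((B t w - B s w) j 0)] = incr s t j @^-1` U.
  by apply/seteqP; split => w; rewrite /incr /= !mxE.
apply; have := @measurable_forP 'cV[R]_d R d 1 <<s open >> id j 0.
by apply.
Qed.

Lemma increment_law s t j (U : set R) : 0 <= s -> s < t -> measurable U ->
  P (incr s t j @^-1` U) = normal_prob 0 (Num.sqrt (t - s)) U.
Proof.
move=> s0 st mU; have [_ _ _ _ /(_ s t s0 st)] := B_brownian.
move=> /(_ (fun i => if i == j then U else setT)).
have -> : [set w | forall i, (if i == j then U else setT) ((B t w - B s w) i 0)] =
    incr s t j @^-1` U.
  apply/seteqP; split => w /=; rewrite /incr.
    by move=> /(_ j); rewrite eqxx !mxE.
  by move=> Uw i; case: eqP => // ->; rewrite !mxE.
move=> ->; last by move=> i; case: ifP.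
rewrite (bigD1 j) //= eqxx big1 ?mule1 // => i /negbTE ->.
exact: probability_setT.
Qed.

Lemma increment_moments s t j : 0 <= s -> s <= t ->
  [/\ P.-integrable setT (EFin \o incr s t j),
      (\int[P]_w (incr s t j w)%:E = 0)%E,
      P.-integrable setT (fun w => (incr s t j w ^+ 2)%:E)
    & (\int[P]_w (incr s t j w ^+ 2)%:E <= (8 * (t - s))%:E)%E].
Proof.
move=> s0; rewrite le_eqVlt => /orP[/eqP <-|st].
  have -> : incr s s j = fun=> 0 by apply/funext => w; rewrite /incr subrr.
  rewrite expr0n /= subrr mulr0 integral0; split => //; exact: integrable0.
have sd : 0 < Num.sqrt (t - s) by rewrite sqrtr_gt0 subr_gt0.
have mZ := increment_measurable j s0 (ltW st).
have lZ (U : set R) := @increment_law s t j U s0 st.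
have [? ?] := normal_expectation0 sd mZ lZ.
split => //; first exact: normal_sqr_integrable sd mZ lZ.
have := normal_sqr_expectation_le sd mZ lZ.
by rewrite sqr_sqrtr // subr_ge0 ltW.
Qed.

(** Each coefficient is known at the left end of its interval, so the sum is a martingale transform
    along the filtration [F (tau k)], with variances at most 8 times the lengths of the
    intervals. *)
Lemma discrete_integral_tail (tau : nat -> R) (c : nat -> T -> R) (j : 'I_d) n (delta e : R) :
  (forall k, 0 <= tau k) -> (forall k, tau k <= tau k.+1) ->
  (forall k, gmeasurable (F (tau k)) (c k)) ->
  (forall k, exists M, forall w, `|c k w| <= M) ->
  0 <= delta -> 0 < e ->
  (P [set w | (e <= `|\sum_(k < n) c k w * (B (tau k.+1) w j 0 - B (tau k) w j 0)|)%R] <=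
   P [set w | (delta < \sum_(k < n) c k w ^+ 2 * (8 * (tau k.+1 - tau k)))%R]
   + (delta / e ^+ 2)%:E)%E.
Proof.
move=> tau0 tauS mc bc delta0 e0.
apply: (@transform_tail _ _ _ P (fun k => F (tau k)) (fun k => incr (tau k) (tau k.+1) j)
  (fun k => 8 * (tau k.+1 - tau k)) _ _ _ _ _ _ _ _ _ c) => //.
- by move=> k; exact: sF.
- by move=> k; exact: Fm.
- by move=> k; exact: Fle.
- by move=> k; exact: increment_gmeasurable.
- by move=> k A U FA mU; exact: increment_independent.
- by move=> k; case: (increment_moments j (tau0 k) (tauS k)).
- by move=> k; case: (increment_moments j (tau0 k) (tauS k)).
- by move=> k; case: (increment_moments j (tau0 k) (tauS k)).
- by move=> k; case: (increment_moments j (tau0 k) (tauS k)).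
Qed.

End brownian.

Lemma measurable_mx_norm (disp : measure_display) (T : measurableType disp) (R : realType)
    m n (D : set T) (A : T -> 'M[R]_(m, n)) :
  (forall i j, measurable_fun D (fun w => A w i j)) -> measurable_fun D (fun w => `|A w|).
Proof.
move=> mA.
have -> : (fun w => `|A w|) = (fun w => \big[Num.max/0]_ij `|A w ij.1 ij.2|).
  by apply/funext => w; rewrite -mx_normrE.
elim: (index_enum _) => [|ij s IH].
  have -> : (fun w => \big[Num.max/0]_(ij <- [::]) `|A w ij.1 ij.2|) = (fun=> 0).
    by apply/funext => w; rewrite big_nil.
  exact: measurable_cst.
have -> : (fun w => \big[Num.max/0]_(ij <- ij :: s) `|A w ij.1 ij.2|) =
  (fun w => `|A w ij.1 ij.2|) \max (fun w => \big[Num.max/0]_(ij <- s) `|A w ij.1 ij.2|).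
  by apply/funext => w; rewrite big_cons.
by apply: measurable_maxr => //; apply: measurableT_comp.
Qed.

(** * Simple processes minus a constant matrix, on a grid of [0, t] *)

Section simple_process_grid.
Context (T : pointedType) (R : realType) (d : nat) (F : R -> set (set T)).
Variables (H : simple_process d F) (t : R) (M : 'M[R]_d).
Hypothesis t_ge0 : 0 <= t.

(* The times of H clipped at t, with 0 and t added at the two ends: H - M does not vanish
   on the parts of ]0, t] where H is not defined. *)
Definition grid (k : nat) : R :=
  if k is k'.+1 then
    if (k' <= sp_size H)%N then Num.min (sp_time H k') t else t
  else 0.

(* A coefficient attached to a time beyond t would not be F_t-measurable; its interval is
   empty after clipping, hence the 0. *)
Definition grid_coef (k : nat) (w : T) : 'M[R]_d :=
  if k is k'.+1 then
    if (k' < sp_size H)%N then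
      if sp_time H k' < t then sp_coef H k' w - M else 0
    else - M
  else - M.

Let time_le j k : (j <= k)%N -> sp_time H j <= sp_time H k.
Proof.
move=> /subnK <-; elim: (k - j)%N => // n IH; rewrite addSn.
exact: le_trans IH (sp_time_nondecreasing _ _).
Qed.

Let time_ge0 k : 0 <= sp_time H k.
Proof. exact: le_trans (sp_time_ge0 H) (time_le (leq0n k)). Qed.

Lemma grid_ge0 k : 0 <= grid k.
Proof. by case: k => [|k] //=; case: ifP => // _; rewrite le_min time_ge0 t_ge0. Qed.

Lemma grid_nondecreasing k : grid k <= grid k.+1.
Proof.
case: k => [|k] /=; first by rewrite le_min time_ge0 t_ge0.
have [ks|ks] := ltnP k (sp_size H).
  by rewrite (ltnW ks) le_min2 // sp_time_nondecreasing.
by case: ifP => // _; rewrite ge_min lexx orbT.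
Qed.


Lemma grid_coef_bounded k i j : exists K, forall w, `|grid_coef k w i j| <= K.
Proof.
case: k => [|k] /=; first by exists `|M|; move=> w; rewrite mxE normrN mx_coord_le.
case: (ltnP k (sp_size H)) => _; last by exists `|M|; move=> w; rewrite mxE normrN mx_coord_le.
case: (ltP (sp_time H k) t) => _; last by exists 0 => w; rewrite mxE normr0.
have [K HK] := sp_coef_bounded H k; exists (K + `|M|) => w.
apply: le_trans (mx_coord_le _ _ _) _; apply: le_trans (ler_normB _ _) _.
exact: lerD.
Qed.

(** M (B_t - B_0) telescopes along the grid; on the two end intervals, where H vanishes, the
    coefficient left is -M. *)
Lemma grid_integralE (B : R -> T -> 'cV[R]_d) w :
  simple_integral B H t w - M *m (B t w - B 0 w) =
  \sum_(k < (sp_size H).+2) grid_coef k w *m (B (grid k.+1) w - B (grid k) w).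
Proof.
rewrite big_ord_recl big_ord_recr /= ltnn leqnn /=.
pose tm k := Num.min (sp_time H k) t.
have -> : \sum_(i < sp_size H)
     grid_coef (bump 0 i) w *m (B (grid (bump 0 i).+1) w - B (grid (bump 0 i)) w) =
   \sum_(i < sp_size H) (sp_coef H i w - M) *m (B (tm i.+1) w - B (tm i) w).
  apply: eq_bigr => -[k ks] _ /=; rewrite /bump /= add1n ks (ltnW ks).
  case: ifPn => // tk; rewrite -leNgt in tk.
  have -> : tm k = t by rewrite /tm; apply/min_idPr.
  have -> : tm k.+1 = t.
    by rewrite /tm; apply/min_idPr; exact: le_trans tk (sp_time_nondecreasing _ _).
  by rewrite subrr mul0mx mulmx0.
under eq_bigr do rewrite mulmxBl.
rewrite sumrB -mulmx_sumr -(big_mkord xpredT (fun i => B (tm i.+1) w - B (tm i) w)) telescope_sumr // -/(tm 0%N) -/(tm (sp_size H)).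
rewrite /simple_integral -/(tm _) !mulNmx !mulmxBr !opprB.
move: (\sum_i _) (M *m _) (M *m B (tm 0%N) w) (M *m B (tm (sp_size H)) w) (M *m B t w).
move=> S x y z u.
have E : S + (x - u) = x - y + (S + (y - z) + (z - u)).
  by apply/matrixP => i j; rewrite !mxE; ring.
exact: E.
Qed.

Lemma grid_coefE k w s : (k < (sp_size H).+2)%N -> grid k < s -> s <= grid k.+1 ->
  simple_value H s w - M = grid_coef k w.
Proof.
have out (l : 'I_(sp_size H)) : s <= sp_time H l \/ sp_time H l.+1 < s ->
    (\1_(`]sp_time H l, sp_time H l.+1]) s : R) = 0.
  move=> h; rewrite indicE memNset //= in_itv /= => /andP[h1 h2].
  by case: h => h; [have := lt_le_trans h1 h|have := le_lt_trans h2 h]; rewrite ltxx.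
case: k => [|k] /= kn.
  move=> s0; rewrite le_min => /andP[sl st].
  rewrite /simple_value big1 ?sub0r // => l _; rewrite out ?scale0r //.
  by left; exact: le_trans sl (time_le _).
rewrite !ltnS in kn; rewrite kn.
have after m : (m <= sp_size H)%N -> Num.min (sp_time H m) t < s -> s <= t ->
    sp_time H m < t /\ sp_time H m < s.
  move=> _; rewrite gt_min => /orP[h|h] st; last by have := lt_le_trans h st; rewrite ltxx.
  by split=> //; exact: lt_le_trans h st.
have [ks|ks] := ltnP k (sp_size H).
  rewrite le_min => tks /andP[sk st].
  have [tkt tk] := after k (ltnW ks) tks st; rewrite tkt.
  congr (_ - _); rewrite /simple_value (bigD1 (Ordinal ks)) //= big1 ?addr0.
    by rewrite indicE mem_set ?scale1r //= in_itv /= tk.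
  move=> l lk; rewrite out ?scale0r //.
  have [lk'|lk'|lk'] := ltngtP l k.
  - by right; exact: le_lt_trans (time_le lk') tk.
  - by left; exact: le_trans sk (time_le lk').
  - by case/eqP: lk; exact: val_inj.
have -> : k = sp_size H by apply/eqP; rewrite eqn_leq ks kn.
move=> tks st; have [_ tk] := after _ (leqnn _) tks st.
rewrite /simple_value big1 ?sub0r // => l _; rewrite out ?scale0r //.
by right; exact: le_lt_trans (time_le _) tk.
Qed.

Lemma simple_value_measurable w i j : measurable_fun setT (fun s => simple_value H s w i j).
Proof.
have -> : (fun s => simple_value H s w i j) =
  (fun s => \sum_(k < sp_size H) (\1_(`]sp_time H k, sp_time H k.+1]) s : R) * sp_coef H k w i j).
  by apply/funext => s; rewrite /simple_value summxE; apply: eq_bigr => k _; rewrite mxE.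
by apply: measurable_sum => k; apply: measurable_funM.
Qed.

(** H - M is constant on each half-open cell of the grid, and the cells fill ]0, t]. This links the
    random sum in the discrete tail bound to the pathwise integral that [ito_integral] controls. *)
Lemma grid_sqr_integral w i j :
  (\int[lebesgue_measure]_(s in `]0%R, t]) (((simple_value H s w - M) i j) ^+ 2)%:E =
  (\sum_(k < (sp_size H).+2) grid_coef k w i j ^+ 2 * (grid k.+1 - grid k))%:E)%E.
Proof.
pose h s := ((simple_value H s w - M) i j) ^+ 2.
have mh : measurable_fun setT h.
  apply: measurable_funX.
  have -> : (fun s => (simple_value H s w - M) i j) = (fun s => simple_value H s w i j - M i j).
    by apply/funext => s; rewrite !mxE.
  by apply: measurable_funB => //; exact: simple_value_measurable.
(* The last grid point is t by the default branch of [grid]; the induction on the number of cells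
   that follows needs the right end to be a grid point. *)
have gE : t = grid (sp_size H).+2 by rewrite /= ltnn.
suff IH n : (n <= (sp_size H).+2)%N ->
    (\int[lebesgue_measure]_(s in `]0%R, grid n]) (h s)%:E =
     (\sum_(k < n) grid_coef k w i j ^+ 2 * (grid k.+1 - grid k))%:E)%E.
  by rewrite [X in `]_, X]]gE; exact: IH.
elim: n => [_|n IH nS].
  by rewrite big_ord0 /= set_itvoc0 integral_set0.
have U : `]0%R, grid n.+1]%classic = `]0%R, grid n] `|` `]grid n, grid n.+1].
  apply/seteqP; split => s /=; rewrite !in_itv /=.
    by move=> /andP[s0 s1]; have [sn|sn] := leP s (grid n); [left|right]; rewrite ?s0 ?s1.
  move=> [|] /andP[s0 s1]; rewrite ?s0 ?s1 /=.
    exact: le_trans s1 (grid_nondecreasing n).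
  by rewrite (le_lt_trans (grid_ge0 n) s0).
rewrite U ge0_integral_setU //; last 3 first.
- by apply/measurable_EFinP/measurable_funTS.
- by move=> s _; rewrite lee_fin sqr_ge0.
- apply/disj_setPS => s /= []; rewrite !in_itv /= => /andP[_ s1] /andP[s2 _].
  by have := le_lt_trans s1 s2; rewrite ltxx.
rewrite IH ?(ltnW nS) // big_ord_recr /= EFinD; congr (_ + _)%E.
rewrite (eq_integral (fun=> (grid_coef n w i j ^+ 2)%:E)); last first.
  move=> s /[!inE] sI; have : s \in `]grid n, grid n.+1] := sI.
  by rewrite in_itv => /andP[s0 s1]; rewrite /h (@grid_coefE n w s).
rewrite integral_cst //= lebesgue_measure_itv /= lte_fin -EFinB -!/(grid n.+1).
have := grid_nondecreasing n; rewrite le_eqVlt => /orP[/eqP <-|->].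
  by rewrite ltxx subrr mulr0 mule0.
by rewrite EFinM.
Qed.

End simple_process_grid.

Lemma measure_exists_le (disp : measure_display) (T : measurableType disp) (R : realType)
    (P : {measure set T -> \bar R}) (I : finType) (E : I -> set T) :
  (forall i, measurable (E i)) ->
  measurable [set w | exists i, E i w] /\
  (P [set w | exists i, E i w] <= \sum_i P (E i))%E.
Proof.
move=> mE.
have -> : [set w | exists i, E i w] = [set w | exists2 i, i \in index_enum I & E i w].
  by apply/seteqP; split => w [i]; [exists i; rewrite ?mem_index_enum|exists i].
elim: (index_enum I) => [|i s [ms IH]].
  have -> : [set w | exists2 i, i \in [::] & E i w] = set0 by apply/seteqP; split => w // [].
  by rewrite big_nil measure0.
have -> : [set w | exists2 j, j \in i :: s & E j w] = E i `|` [set w | exists2 j, j \in s & E j w].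
  apply/seteqP; split => w.
    by case=> j; rewrite inE => /orP[/eqP -> Ew|js Ew]; [left|right; exists j].
  by case=> [Ew|[j js Ew]]; [exists i; rewrite ?mem_head|exists j; rewrite // inE js orbT].
split; first exact: measurableU.
rewrite big_cons; apply: le_trans (measureU2 _ _ _) _ => //.
exact: leeD.
Qed.

Lemma within_continuous_coord (R : realType) m n (D : set R) (K : R -> 'M[R]_(m, n)) i j :
  {within D, continuous K} -> {within D, continuous (fun s => K s i j)}.
Proof.
move=> cK s; apply: (@continuous_comp _ _ _ (K : subspace D -> _) (fun A : 'M[R]_(m, n) => A i j)).
  exact: cK.
exact: coord_continuous.
Qed.

(** * Tail bounds for the integral of a simple process minus a constant *)

Section ito_close.
Context (R : realType) (d : nat) (disp : measure_display) (T : measurableType disp)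
  (P : probability T R) (F : R -> set (set T)).
Hypothesis F_filtration : filtration F.
Variable B : R -> T -> 'cV[R]_d.
Hypothesis B_brownian : brownian_motion P F B.

Let sF t : 0 <= t -> sigma_algebra setT (F t).
Proof. by case: F_filtration => + _ _; apply. Qed.

Let Fm t : 0 <= t -> F t `<=` measurable.
Proof. by case: F_filtration => _ + _; apply. Qed.

Lemma grid_coef_gmeasurable (H : simple_process d F) t M k i j : 0 <= t ->
  gmeasurable (F (grid H t k)) (fun w => grid_coef H t M k w i j).
Proof.
move=> t0; have sG := sF (grid_ge0 H t0 k).
have cstM : gmeasurable (F (grid H t k)) (fun w : T => (- M) i j) by exact: gmeasurable_cst.
case: k sG cstM => [//|k] sG cstM.
rewrite /grid_coef; case: (ltnP k (sp_size H)) => [ks|//].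
case: (ltP (sp_time H k) t) => [kt|_]; last exact: gmeasurable_cst.
have -> : (fun w => (sp_coef H k w - M) i j) = (fun w => sp_coef H k w i j + (- M) i j).
  by apply/funext => w; rewrite !mxE.
apply: gmeasurableD => //.
have -> : grid H t k.+1 = sp_time H k by rewrite /= (ltnW ks); apply/min_idPl/ltW.
by apply: measurable_forP; exact: sp_coef_measurable.
Qed.

(** The share of the j-th Brownian coordinate in the i-th entry of the integral of H - M; the scalar
    martingale bound is applied to each pair (i, j). *)
Definition grid_sum (H : simple_process d F) t M i j w : R :=
  \sum_(k < (sp_size H).+2) grid_coef H t M k w i j
     * (B (grid H t k.+1) w j 0 - B (grid H t k) w j 0).

Lemma grid_sum_measurable (H : simple_process d F) t M i j : 0 <= t ->
  measurable_fun setT (grid_sum H t M i j).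
Proof.
move=> t0; apply: measurable_sum => k; apply: measurable_funM.
  by apply: (gmeasurable_measurable (Fm (grid_ge0 H t0 k))); exact: grid_coef_gmeasurable.
apply: (increment_measurable F_filtration B_brownian j); first exact: grid_ge0.
exact: grid_nondecreasing.
Qed.

(** Split H - M as (H - K) + (K - M) and use (a + r)^2 <= 2 a^2 + 2 r^2: the first part tends to 0
    along the approximation, the second is at most r on an interval of length t. *)
Lemma grid_energy_le (H : simple_process d F) (K : R -> 'M[R]_d) t M r i j w :
  0 <= t -> {within `[0, +oo[, continuous K} ->
  (forall s, 0 <= s -> s <= t -> `|K s - M| <= r) ->
  ((\sum_(k < (sp_size H).+2) grid_coef H t M k w i j ^+ 2 * (grid H t k.+1 - grid H t k))%:E
   <= 2%:E * \int[lebesgue_measure]_(s in `[0%R, t])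
        ((`|simple_value H s w - K s| ^+ 2)%R)%:E + (2 * (r ^+ 2 * t))%:E)%E.
Proof.
move=> t0 cK KM.
have mKij i' j' : measurable_fun `[0, t] (fun s => K s i' j').
  apply: subspace_continuous_measurable_fun => //.
  have := @within_continuous_coord _ _ _ _ _ i' j' cK.
  by apply: continuous_subspaceW => s /=; rewrite !in_itv /= => /andP[->].
have mn : measurable_fun `[0, t] (fun s => `|simple_value H s w - K s| ^+ 2).
  apply: measurable_funX; apply: measurable_mx_norm => i' j'.
  have -> : (fun s => (simple_value H s w - K s) i' j') =
      (fun s => simple_value H s w i' j' - K s i' j').
    by apply/funext => s; rewrite !mxE.
  apply: measurable_funB => //; apply: measurable_funTS.
  exact: simple_value_measurable.
rewrite -(grid_sqr_integral _ _ t0).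
have oc : `]0, t]%classic `<=` `[0, t]%classic.
  by apply: subset_itvr; rewrite bnd_simp.
have mn' := measurable_funS _ oc mn.
have mn1 : measurable_fun `]0, t] (fun s => (2 * `|simple_value H s w - K s| ^+ 2)%R%:E).
  by apply/measurable_EFinP; apply: measurable_funM => //; exact: mn'.
apply: (@le_trans _ _ (\int[lebesgue_measure]_(s in `]0%R, t])
   ((2 * `|simple_value H s w - K s| ^+ 2)%R%:E + (2 * r ^+ 2)%R%:E))%E).
  apply: ge0_le_integral => //.
  - by move=> s _; rewrite lee_fin sqr_ge0.
  - apply/measurable_EFinP/measurable_funTS/measurable_funX.
    have -> : (fun s => (simple_value H s w - M) i j) = (fun s => simple_value H s w i j - M i j).
      by apply/funext => s; rewrite !mxE.
    by apply: measurable_funB => //; exact: simple_value_measurable.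
  - by apply: emeasurable_funD.
  - move=> s /=; rewrite in_itv /= => /andP[s0 st]; rewrite -EFinD lee_fin.
    apply: (@le_trans _ _ (`|simple_value H s w - M| ^+ 2)).
      by rewrite -[leLHS]real_normK ?num_real // lerXn2r ?nnegrE // mx_coord_le.
    have r0 : 0 <= r by apply: le_trans (KM _ (ltW s0) st).
    have : `|simple_value H s w - M| <= `|simple_value H s w - K s| + r.
      rewrite -[simple_value H s w - M](subrKA (K s)).
      by apply: le_trans (ler_normD _ _) _; rewrite lerD2l; exact: KM (ltW s0) st.
    have := normr_ge0 (simple_value H s w - M).
    have := normr_ge0 (simple_value H s w - K s).
    move: `|simple_value H s w - K s| `|simple_value H s w - M| => a c a0 c0 ca.
    have : c ^+ 2 <= (a + r) ^+ 2 by apply: lerXn2r; rewrite // nnegrE addr_ge0.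
    have := sqr_ge0 (a - r); rewrite sqrrB sqrrD => ? ?; lra.
rewrite ge0_integralD //; last by move=> s _; rewrite lee_fin mulr_ge0 ?sqr_ge0.
apply: leeD.
  under eq_integral do rewrite EFinM.
  rewrite ge0_integralZl //; last by apply/measurable_EFinP; exact: mn'.
  apply: lee_wpmul2l; first by rewrite lee_fin.
  apply: ge0_subset_integral => //.
  exact/measurable_EFinP.
rewrite integral_cst //= lebesgue_measure_itv /= lte_fin.
case: ltP => _; first by rewrite oppr0 addr0 -EFinM lee_fin mulrA.
by rewrite mule0 lee_fin mulr_ge0 // mulr_ge0 // sqr_ge0.
Qed.

Lemma grid_sum_tail (H : simple_process d F) (K : R -> T -> 'M[R]_d) t M r i j (N : set T) (eta e : R) :
  0 <= t -> (forall w, {within `[0, +oo[, continuous (K ^~ w)}) ->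
  measurable N ->
  (forall w s, ~ N w -> 0 <= s -> s <= t -> `|K s w - M| <= r) ->
  measurable_fun setT (fun w => (\int[lebesgue_measure]_(s in `[0%R, t])
     ((`|simple_value H s w - K s w| ^+ 2)%R)%:E)%E) ->
  0 < eta -> 0 < e ->
  (P [set w | (e <= `|grid_sum H t M i j w|)%R] <=
   P N + P [set w | eta%:E <= \int[lebesgue_measure]_(s in `[0%R, t])
     ((`|simple_value H s w - K s w| ^+ 2)%R)%:E] +
   (16 * (r ^+ 2 * t + eta) / e ^+ 2)%:E)%E.
Proof.
move=> t0 cK mN KM mZ eta0 e0.
set Z := (X in measurable_fun setT X) in mZ *.
have mZe : measurable [set w | (eta%:E <= Z w)%E].
  by rewrite -[X in measurable X]setTI; exact: emeasurable_fun_c_infty.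
(* 16 = 8 * 2, from the variance bound and from [grid_energy_le]: off N, if the weighted sum of
   squares exceeds this level, then the approximation error Z exceeds eta. *)
have d0 : 0 <= 16 * (r ^+ 2 * t + eta).
  by rewrite mulr_ge0 // addr_ge0 ?(ltW eta0) // mulr_ge0 ?sqr_ge0.
have h := discrete_integral_tail F_filtration B_brownian j (sp_size H).+2
  (grid_ge0 H t0) (grid_nondecreasing H t0) (fun k => @grid_coef_gmeasurable H t M k i j t0)
  (fun k => grid_coef_bounded H t M k i j) d0 e0.
apply: le_trans h _; apply: leeD => //.
apply: le_trans (measureU2 _ _ _) => //.
have mQ : measurable_fun setT (fun w => \sum_(k < (sp_size H).+2)
    grid_coef H t M k w i j ^+ 2 * (8 * (grid H t k.+1 - grid H t k))).
  apply: measurable_sum => k; apply: measurable_funM => //; apply: measurable_funX.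
  by apply: (gmeasurable_measurable (Fm (grid_ge0 H t0 k))); exact: grid_coef_gmeasurable.
apply: le_measure; rewrite ?inE.
- exact: measurable_gt_level.
- exact: measurableU.
move=> w /= dw; have [Nw|Nw] := pselect (N w); [by left|right => /=].
rewrite leNgt; apply/negP; rewrite -/(Z w) => Zw.
have : (_ <= 2%:E * Z w + (2 * (r ^+ 2 * t))%:E)%E :=
  @grid_energy_le H (K ^~ w) t M r i j w t0 (cK w) (fun s => KM w s Nw).
have Zf : Z w \is a fin_num.
  rewrite ge0_fin_numE ?(lt_trans Zw) ?ltry //.
  by apply: integral_ge0 => s _; rewrite lee_fin sqr_ge0.
rewrite -(fineK Zf) -EFinM -EFinD lee_fin => Q.
move: Zw; rewrite -(fineK Zf) lte_fin => Zw.
move: dw; under eq_bigr do rewrite mulrCA.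
rewrite -mulr_sumr ltNge => /negP; apply.
move: Q; move: (\sum_(_ < _) _) (fine _) Zw (r ^+ 2 * t) => a b ? c; lra.
Qed.

End ito_close.

(** * Ito integrals of nearly constant integrands *)

Lemma within_continuous_dist (R : realType) (V : normedModType R) (D : set R) (f : R -> V) t e :
  {within D, continuous f} -> D t -> 0 < e ->
  exists2 delta, 0 < delta & forall s, D s -> `|t - s| < delta -> `|f t - f s| < e.
Proof.
move=> /subspace_continuousP cf Dt e0.
have /cvgrPdist_lt /(_ e e0) := cf t Dt.
rewrite near_withinE => /nbhs_ballP[delta /= delta0 h].
by exists delta => // s Ds ts; apply: h.
Qed.

Lemma dist_le_continuous (R : realType) (V W : normedModType R) (f : V -> W) (L : R) :
  (forall x y, `|f x - f y| <= L * `|x - y|) -> continuous f.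
Proof.
move=> fL x; apply/cvgrPdist_lt => e e0.
have L0 : 0 < `|L| + 1 by rewrite ltr_wpDl.
near=> y.
apply: le_lt_trans (fL x y) _; apply: (@le_lt_trans _ _ ((`|L| + 1) * `|x - y|)).
  by rewrite ler_wpM2r // (le_trans (ler_norm L)) // lerDl.
rewrite -ltr_pdivlMl //; near: y.
apply: cvgr_dist_lt; first exact: cvg_id.
by rewrite mulr_gt0 ?invr_gt0.
Unshelve. all: by end_near. Qed.

Lemma mulmx_continuous (R : realType) m n p (M : 'M[R]_(m, n)) :
  continuous (fun v : 'M[R]_(n, p) => M *m v).
Proof.
apply: (@dist_le_continuous _ _ _ _ (n%:R * `|M|)) => x y.
by rewrite -mulmxBr mx_norm_mulmx.
Qed.

(** One null set serves all nonnegative rational times, and continuity carries the equality from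
    them to every time. *)
Lemma ae_eq_continuous_paths (disp : measure_display) (T : measurableType disp)
    (R : realType) (P : probability T R) (V : normedModType R) (Y Z : R -> T -> V) :
  continuous_paths Y -> continuous_paths Z ->
  (forall t, 0 <= t -> {ae P, forall w, Y t w = Z t w}) ->
  {ae P, forall w, forall t, 0 <= t -> Y t w = Z t w}.
Proof.
move=> cY cZ YZ.
(* An enumeration of the nonnegative rationals; negative rationals and invalid codes are sent to the
   time 0. *)
pose q (k : nat) : R := if unpickle k is Some x then Num.max 0 (ratr x) else 0.
have q0 k : 0 <= q k by rewrite /q; case: unpickle => // x; rewrite le_max lexx.
apply: negligibleS (negligible_bigcup (fun k => YZ (q k) (q0 k))) => w /= YZw.
apply: contrapT => good; apply: YZw => t t0.
apply/eqP; rewrite -subr_eq0 -normr_eq0; apply/negP => /negP n0.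
have {}n0 : 0 < `|Y t w - Z t w| by rewrite lt_def n0 /=.
pose e := `|Y t w - Z t w| / 2.
have e0 : 0 < e by rewrite divr_gt0.
have Dt : `[0, +oo[%classic t by rewrite /= in_itv /= t0.
have [d1 d10 h1] := within_continuous_dist (cY w) Dt e0.
have [d2 d20 h2] := within_continuous_dist (cZ w) Dt e0.
have [x] : exists x : rat, ratr x \in `]t, (t + Num.min d1 d2)[.
  by apply: rat_in_itvoo; rewrite ltrDl lt_min d10.
rewrite in_itv /= => /andP[tx xt].
have qx : q (pickle x) = ratr x.
  by rewrite /q pickleK; apply/max_idPr; rewrite (le_trans t0) // ltW.
have Dx : `[0, +oo[%classic (ratr x : R) by rewrite /= in_itv /= (le_trans t0) // ltW.
have tx_dist : `|t - ratr x| < Num.min d1 d2.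
  by rewrite distrC ger0_norm ?subr_ge0 ?(ltW tx) // ltrBlDl.
move: tx_dist; rewrite lt_min => /andP[tx1 tx2].
have eqx : Y (ratr x) w = Z (ratr x) w.
  by rewrite -qx; apply: contrapT => bad; apply: good; exists (pickle x).
have := h1 _ Dx tx1; have := h2 _ Dx tx2; rewrite eqx => l2 l1.
suff : `|Y t w - Z t w| < `|Y t w - Z t w| by rewrite ltxx.
rewrite {1}(_ : Y t w - Z t w = (Y t w - Z (ratr x) w) - (Z t w - Z (ratr x) w)); last first.
  by rewrite opprB addrA subrK.
apply: le_lt_trans (ler_normB _ _) _.
by rewrite [ltRHS]splitr ltrD.
Qed.

Section ito_close_main.
Context (R : realType) (d : nat) (disp : measure_display) (T : measurableType disp)
  (P : probability T R) (F : R -> set (set T)).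
Hypothesis F_filtration : filtration F.
Variable B : R -> T -> 'cV[R]_d.
Hypothesis B_brownian : brownian_motion P F B.

Lemma adapted_measurable (Y : R -> T -> 'cV[R]_d) t i : adapted F Y -> 0 <= t ->
  measurable_fun setT (fun w => Y t w i 0).
Proof.
move=> aY t0; case: F_filtration => _ Fm _.
by apply: (gmeasurable_measurable (Fm t t0)); apply: measurable_forP; exact: aY.
Qed.

Lemma ito_residual_measurable (I : R -> T -> 'cV[R]_d) (M : 'M[R]_d) t : adapted F I -> 0 <= t ->
  measurable_fun setT (fun w => `|I t w - M *m (B t w - B 0 w)|).
Proof.
move=> aI t0; apply: measurable_mx_norm => i j; rewrite (ord1 j).
have -> : (fun w => (I t w - M *m (B t w - B 0 w)) i 0) =
   (fun w => I t w i 0 - \sum_(k < d) M i k * (B t w k 0 - B 0 w k 0)).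
  by apply/funext => w; rewrite !mxE; congr (_ - _); apply: eq_bigr => k _; rewrite !mxE.
apply: measurable_funB; first exact: adapted_measurable.
apply: measurable_sum => k; apply: measurable_funM => //.
by case: B_brownian => aB _ _ _ _; apply: measurable_funB; exact: adapted_measurable.
Qed.

Lemma simple_integral_close (H : simple_process d F) t M e w : 0 <= t -> 0 < e ->
  (forall i j, `|grid_sum B H t M i j w| < e / d.+1%:R) ->
  `|simple_integral B H t w - M *m (B t w - B 0 w)| <= e.
Proof.
move=> t0 e0 h; rewrite grid_integralE; apply: mx_norm_le => [|i k]; first exact: ltW.
rewrite (ord1 k) summxE.
under eq_bigr do rewrite mxE.
rewrite exchange_big /=.
apply: le_trans (ler_norm_sum _ _ _) _.
apply: (@le_trans _ _ (\sum_(j < d) (e / d.+1%:R))).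
  apply: ler_sum => j _; apply: le_trans (ltW (h i j)).
  rewrite le_eqVlt; apply/orP; left; apply/eqP; congr `|_|.
  by apply: eq_bigr => l _; rewrite !mxE.
rewrite sumr_const card_ord -[leLHS]mulr_natr mulrAC ler_pdivrMr // ler_pM2l // ler_nat.
exact: leqnSn.
Qed.

(** Off N the integrand is within r of M, so the residual has order r sqrt t. The threshold e is
    halved, for the simple integral and for its distance to I, and the first half is shared among d
    coordinates, with d + 1 instead of d to avoid dividing by 0: this turns 16 into 64 (d + 1)^2.
    The union bound over the entries gives the factor d * d, also in front of P N. *)
Lemma ito_close (K : R -> T -> 'M[R]_d) (I : R -> T -> 'cV[R]_d) t M r (N : set T) e :
  ito_integral P F B K I ->
  0 <= t -> (forall w, {within `[0, +oo[, continuous (K ^~ w)}) ->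
  measurable N ->
  (forall w s, ~ N w -> 0 <= s -> s <= t -> `|K s w - M| <= r) ->
  0 < e ->
  (P [set w | (e <= `|I t w - M *m (B t w - B 0 w)|)%R] <=
   ((d * d)%:R * (fine (P N) + 64 * d.+1%:R ^+ 2 * (r ^+ 2 * t) / e ^+ 2))%:E)%E.
Proof.
move=> [aI _ [Hn HnK]] t0 cK mN KM e0.
have [[mZ cZ] [mD cD]] := HnK t t0.
apply/lee_addgt0Pr => kappa kappa0.
set D2 : R := d.+1%:R ^+ 2.
have D20 : 0 < D2 by rewrite exprn_gt0.
set dd : R := (d * d)%:R.
have dd0 : 0 <= dd by [].
have dd1 : 0 < 1 + dd by rewrite ltr_pwDl.
(* Three errors must add up to at most kappa: p for the distance of the simple integral to I, dd * p
   for the distance of the integrands, and again dd * p from eta, which is chosen so that 64 (d +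
   1)^2 eta / e^2 = p. *)
pose p := kappa / (2 * (1 + dd)).
have p0 : 0 < p by rewrite divr_gt0 // mulr_gt0.
pose eta := kappa * e ^+ 2 / (128 * D2 * (1 + dd)).
have eta0 : 0 < eta by rewrite divr_gt0 ?mulr_gt0 ?exprn_gt0.
have e20 : 0 < e / 2 by rewrite divr_gt0.
have near_small (Y : nat -> T -> \bar R) (c : R) : 0 < c ->
    (forall e, 0 < e -> P [set w | (e%:E <= Y n w)%E] @[n --> \oo] --> 0%E) ->
    \forall n \near \oo, (P [set w | (c%:E <= Y n w)%E] <= p%:E)%E.
  move=> c0 /(_ c c0) cY.
  have /fine_cvgP[Yfin Ycvg] := cY.
  have : \forall n \near \oo, fine (P [set w | (c%:E <= Y n w)%E]) < p.
    by apply: (cvgr_lt (0 : R)) p0.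
  apply: filter_app; apply: filterS Yfin => n fin Ylt.
  by rewrite -(fineK fin) lee_fin ltW.
near \oo => n.
have Zp : (P [set w | (eta%:E <= \int[lebesgue_measure]_(s in `[0%R, t])
     ((`|simple_value (Hn n) s w - K s w| ^+ 2)%R)%:E)%E] <= p%:E)%E.
  by near: n; exact: near_small cZ.
have Dp : (P [set w | ((e / 2)%:E <= `|simple_integral B (Hn n) t w - I t w|%:E)%E] <= p%:E)%E.
  by near: n; exact: near_small cD.
pose E0 := [set w | ((e / 2)%:E <= `|simple_integral B (Hn n) t w - I t w|%:E)%E].
have mE0 : measurable E0.
  by rewrite -[X in measurable X]setTI; exact: emeasurable_fun_c_infty.
pose E1 (ij : 'I_d * 'I_d) := [set w | e / 2 / d.+1%:R <= `|grid_sum B (Hn n) t M ij.1 ij.2 w|].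
have mE1 ij : measurable (E1 ij).
  apply: measurable_ge_level; apply: measurableT_comp => //.
  exact: (grid_sum_measurable F_filtration B_brownian).
have [mEx EU] := measure_exists_le P mE1.
have mres : measurable [set w | e <= `|I t w - M *m (B t w - B 0 w)|].
  by apply: measurable_ge_level; exact: ito_residual_measurable.
apply: (@le_trans _ _ (P (E0 `|` [set w | exists ij, E1 ij w]))).
  apply: le_measure; rewrite ?inE //; first exact: measurableU.
  move=> w /= ew; have [Ew|Ew] := pselect (exists ij, E1 ij w); [by right|left].
  rewrite /E0 /= lee_fin leNgt; apply/negP => lt.
  have : `|simple_integral B (Hn n) t w - M *m (B t w - B 0 w)| <= e / 2.
    apply: simple_integral_close => // i j; rewrite ltNge; apply/negP => h.
    by apply: Ew; exists (i, j).
  move=> le2; have := le_lt_trans ew; rewrite (_ : I t w - _ =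
    - (simple_integral B (Hn n) t w - I t w) + (simple_integral B (Hn n) t w - M *m (B t w - B 0 w))); last first.
    by rewrite opprB subrKA.
  move=> /(_ e); rewrite ltxx => h; suff : false by [].
  by apply: h; rewrite (le_lt_trans (ler_normD _ _)) // normrN; lra.
apply: le_trans (measureU2 _ _ _) _ => //.
have PNf : P N \is a fin_num by exact: fin_num_measure.
have EB : (\sum_ij P (E1 ij) <= (dd * (fine (P N) + p + 16 * (r ^+ 2 * t + eta) / (e / 2 / d.+1%:R) ^+ 2))%:E)%E.
  apply: (@le_trans _ _ (\sum_(ij : 'I_d * 'I_d) (fine (P N) + p + 16 * (r ^+ 2 * t + eta) / (e / 2 / d.+1%:R) ^+ 2)%:E)%E).
    apply: lee_sum => -[i j] _.
    have := @grid_sum_tail R d disp T P F F_filtration B B_brownian (Hn n) K t M r i j N eta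
       (e / 2 / d.+1%:R) t0 cK mN KM (mZ n) eta0 (divr_gt0 e20 (ltr0Sn _ _)).
    move/le_trans; apply; rewrite !EFinD fineK //.
    by apply: leeD => //; apply: leeD.
  rewrite sumEFin lee_fin sumr_const card_prod card_ord /dd.
  by rewrite [leRHS]mulr_natl.
apply: (@le_trans _ _ (p%:E + (dd * (fine (P N) + p + 16 * (r ^+ 2 * t + eta) / (e / 2 / d.+1%:R) ^+ 2))%:E)%E).
  by apply: leeD => //; apply: le_trans EU EB.
rewrite -!EFinD lee_fin.
have q0 : 0 < e ^+ 2 by rewrite exprn_gt0.
have -> : 16 * (r ^+ 2 * t + eta) / (e / 2 / d.+1%:R) ^+ 2 = 64 * D2 * (r ^+ 2 * t) / e ^+ 2 + 64 * D2 * eta / e ^+ 2.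
  rewrite /D2; have : (0 : R) < d.+1%:R by [].
  by move: d.+1%:R => u u0; field; rewrite !gt_eqF.
have -> : 64 * D2 * eta / e ^+ 2 = kappa / (2 * (1 + dd)).
  by rewrite /eta; field; rewrite !gt_eqF.
rewrite -/p.
have : p * (1 + dd) = kappa / 2 by rewrite /p; field; rewrite gt_eqF.
move: (64 * D2 * _ / _) (fine _) => a c.
nra.
Unshelve. all: by end_near. Qed.

(** With r = 0 and no exceptional event the bound of [ito_close] is 0 for every e. Countably many e
    settle a fixed time, and path continuity settles all times at once. *)
Lemma ito_close_constant (K : R -> T -> 'M[R]_d) (I : R -> T -> 'cV[R]_d) M :
  ito_integral P F B K I -> (forall s w, K s w = M) ->
  {ae P, forall w, forall t, 0 <= t -> I t w = M *m B t w}.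
Proof.
move=> II KM.
have fixed t : 0 <= t -> {ae P, forall w, I t w = M *m (B t w - B 0 w)}.
  move=> t0.
  have aI : adapted F I by case: II.
  have mI := ito_residual_measurable M aI t0.
  have z e : 0 < e -> P [set w | e <= `|I t w - M *m (B t w - B 0 w)|] = 0%E.
    move=> e0; apply/eqP; rewrite eq_le measure_ge0 andbT.
    have := @ito_close K I t M 0 set0 e II t0 _ measurable0 _ e0.
    rewrite measure0 /= expr0n /= mul0r mulr0 mul0r addr0 mulr0; apply.
      move=> w; have -> : K ^~ w = fun=> M by apply/funext => s; rewrite KM.
      by apply: continuous_subspaceT => s; exact: cvg_cst.
    by move=> w s _ _ _; rewrite KM subrr normr0.
  have nE k : P.-negligible [set w | k.+1%:R^-1 <= `|I t w - M *m (B t w - B 0 w)|].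
    apply/negligibleP; last by apply: z; rewrite invr_gt0.
    exact: measurable_ge_level.
  apply: negligibleS (negligible_bigcup nE) => w /= Iw.
  have : 0 < `|I t w - M *m (B t w - B 0 w)| by rewrite normr_gt0 subr_eq0; apply/eqP.
  by move=> /ltr_add_invr [k]; rewrite add0r => kI; exists k => //=; exact: ltW.
have [aI cI _] := II; have [aB cB B0 _ _] := B_brownian.
apply: (@ae_eq_continuous_paths _ _ _ P _ I (fun t w => M *m B t w)) => //.
  by move=> w s; apply: (@continuous_comp _ _ _ (B ^~ w : subspace _ -> _) (fun v => M *m v));
    [exact: cB|exact: mulmx_continuous].
move=> t t0; have := fixed t t0; apply: filterS2 B0 => w -> ->.
by rewrite subr0.
Qed.

End ito_close_main.

(** * Non-degeneracy of Brownian motion *)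

Section nondegeneracy.
Context (R : realType) (d : nat) (disp : measure_display) (T : measurableType disp)
  (P : probability T R) (F : R -> set (set T)).
Hypothesis F_filtration : filtration F.
Variable B : R -> T -> 'cV[R]_d.
Hypothesis B_brownian : brownian_motion P F B.

(** Brownian scaling: s^2 cancels in the exponent, and the factor 1/s of the peak compensates the
    length (b - a) s, so the bound is free of s. *)
Lemma normal_prob_scaled_ge (s a b : R) : 0 < s -> a < b ->
  ((normal_peak 1 * expR (- (`|a| + `|b|) ^+ 2 / 2) * (b - a))%:E
   <= normal_prob 0 s `[(a * s)%R, (b * s)%R]%classic)%E.
Proof.
move=> s0 ab; have abs : a * s < b * s by rewrite ltr_pM2r.
apply: le_trans (normal_prob_interval_ge s0 abs); rewrite lee_fin.
rewrite !normrM (gtr0_norm s0) -mulrDl -mulrBl exprMn.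
have -> : - ((`|a| + `|b|) ^+ 2 * s ^+ 2) / (s ^+ 2 *+ 2) = - (`|a| + `|b|) ^+ 2 / 2.
  by rewrite -[s ^+ 2 *+ 2]mulr_natr; field; rewrite gt_eqF.
have -> : normal_peak s = normal_peak 1 / s.
  rewrite /normal_peak expr1n mul1r -mulrnAr sqrtrM ?sqr_ge0 // sqrtr_sqr gtr0_norm //.
  by rewrite invfM mulrC.
rewrite le_eqVlt; apply/orP; left; apply/eqP.
by move: (normal_peak 1) (expR _) => u e; field; rewrite gt_eqF.
Qed.

(** Because q does not depend on t, an event of probability below q cannot cover the box at any
    time. *)
Lemma brownian_box_prob (a b : 'I_d -> R) : (forall i, a i < b i) ->
  exists2 q : R, 0 < q & forall t, 0 < t ->
    (q%:E <= P [set w | forall i, (a i * Num.sqrt t <= (B t w - B 0 w) i 0 <= b i * Num.sqrt t)%R])%E.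
Proof.
move=> ab.
exists (\prod_(i < d) (normal_peak 1 * expR (- (`|a i| + `|b i|) ^+ 2 / 2) * (b i - a i))).
  by apply: prodr_gt0 => i _; rewrite !mulr_gt0 ?normal_peak_gt0 ?expR_gt0 ?subr_gt0.
move=> t t0.
have [_ _ _ _ /(_ 0 t (lexx 0) t0)] := B_brownian.
move=> /(_ (fun i => `[a i * Num.sqrt t, b i * Num.sqrt t]%classic) (fun=> measurable_itv _)).
rewrite subr0 => H.
have -> : [set w | forall i, (a i * Num.sqrt t <= (B t w - B 0 w) i 0 <= b i * Num.sqrt t)%R] =
   [set w | forall i, `[a i * Num.sqrt t, b i * Num.sqrt t]%classic ((B t w - B 0 w) i 0)].
  by apply/seteqP; split => w /= h i; have := h i; rewrite /= in_itv.
rewrite H -prodEFin.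
apply: (proj2 (A := (0 <= \prod_(i < d) _)%E)).
apply: (big_ind2 (fun x y : \bar R => 0 <= x /\ x <= y)%E) => [|x1 y1 x2 y2 [x10 x1y1] [x20 x2y2]|i _].
- by [].
- by split; [exact: mule_ge0|exact: lee_pmul].
- split; last by rewrite normal_prob_scaled_ge ?sqrtr_gt0.
  by rewrite lee_fin !mulr_ge0 ?normal_peak_ge0 ?expR_ge0 ?subr_ge0 ?ltW.
Qed.

(* The law of B_t / sqrt t does not depend on t and charges both half spaces
   {v . y >= c} and {v . y <= -c}, so v . B_t is within o(sqrt t)
   of a constant only if v = 0. *)
Lemma brownian_form_eq0 (v : 'I_d -> R) :
  (forall e p : R, 0 < e -> 0 < p -> exists t c N,
     [/\ 0 < t, measurable N, (P N <= p%:E)%E &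
         forall w, ~ N w -> `|\sum_(i < d) v i * (B t w - B 0 w) i 0 - c| <= e * Num.sqrt t]) ->
  forall j, v j = 0.
Proof.
move=> h j; apply/eqP; apply: contrapT => /negP vj.
have vj0 : 0 < `|v j| by rewrite normr_gt0.
pose V := \sum_(i < d) `|v i|.
have V0 : 0 <= V by apply: sumr_ge0.
(* Half-width of the box in the directions other than j: together they contribute at most |v_j| / 2
   * sqrt t to the linear form. *)
pose eta := `|v j| / (2 * (V + 1)).
have V1 : 0 < V + 1 by rewrite ltr_wpDl.
have eta0 : 0 < eta by rewrite divr_gt0 // mulr_gt0.
have etaV : eta * V <= `|v j| / 2.
  rewrite /eta mulrAC ler_pdivrMr ?mulr_gt0 //.
  by move: `|v j| vj0 V1 => ? ? ?; nra.
(* Applied with u = 1 and u = -2: coordinate j has size at least sqrt t and either sign. *)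
have side (u : R) : exists2 q : R, 0 < q & forall t, 0 < t -> forall N, measurable N ->
   (P N < q%:E)%E -> exists2 w, ~ N w &
   (u * Num.sqrt t <= (B t w - B 0 w) j 0 <= (u + 1) * Num.sqrt t) /\
   (forall i, i != j -> `|(B t w - B 0 w) i 0| <= eta * Num.sqrt t).
  have ab i : (if i == j then u else - eta) < (if i == j then u + 1 else eta).
    by case: ifP => _; rewrite ?ltrDl // gtrN.
  have [q q0 Hq] := brownian_box_prob ab.
  exists q => // t t0 N mN PN.
  apply: contrapT => bad.
  suff : (P [set w | forall i, ((if i == j then u else - eta) * Num.sqrt t <=
      (B t w - B 0 w) i 0 <= (if i == j then u + 1 else eta) * Num.sqrt t)%R] <= P N)%E.
    by move=> le; have := le_lt_trans (le_trans (Hq t t0) le) PN; rewrite ltxx.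
  apply: le_measure; rewrite ?inE //.
    have -> : [set w | forall i, ((if i == j then u else - eta) * Num.sqrt t <=
      (B t w - B 0 w) i 0 <= (if i == j then u + 1 else eta) * Num.sqrt t)%R] =
      \bigcap_(i in setT) ((fun w => B t w i 0 - B 0 w i 0) @^-1`
        `[(if i == j then u else - eta) * Num.sqrt t,
          (if i == j then u + 1 else eta) * Num.sqrt t]%classic).
      apply/seteqP; split => w /= H i; first by move=> _; have := H i; rewrite !mxE /= in_itv.
      by have := H i I; rewrite !mxE /= in_itv.
    apply: fin_bigcap_measurable => // i _; rewrite -[X in measurable X]setTI.
    exact: (increment_measurable F_filtration B_brownian i (lexx 0) (ltW t0)).
  move=> w /= H; apply: contrapT => Nw; apply: bad; exists w => //; split.
    by have := H j; rewrite eqxx.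
  by move=> i /negbTE ij; have := H i; rewrite ij ler_norml mulNr.
have [q1 q10 Hq1] := side 1.
have [q2 q20 Hq2] := side (- 2).
pose p := Num.min q1 q2 / 2.
have m0 : 0 < Num.min q1 q2 by rewrite lt_min q10.
have p0 : 0 < p by rewrite divr_gt0.
have pm : p < Num.min q1 q2 by rewrite /p; lra.
(* With tolerance |v_j| / 4 the two sample points give a contradiction: their j-th terms differ by
   at least 2 |v_j| sqrt t, while closeness to c and the other coordinates allow only 2 (1/4 + 1/2)
   |v_j| sqrt t. *)
have [t [c [N [t0 mN PN close]]]] := h (`|v j| / 4) p ltac:(by rewrite divr_gt0) p0.
have s0 : 0 < Num.sqrt t by rewrite sqrtr_gt0.
have PN1 : (P N < q1%:E)%E.
  by apply: le_lt_trans PN _; rewrite lte_fin; move: pm; rewrite lt_min => /andP[].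
have PN2 : (P N < q2%:E)%E.
  by apply: le_lt_trans PN _; rewrite lte_fin; move: pm; rewrite lt_min => /andP[].
have [w1 Nw1 [j1 o1]] := Hq1 t t0 N mN PN1.
have [w2 Nw2 [j2 o2]] := Hq2 t t0 N mN PN2.
have split_sum w : (forall i, i != j -> `|(B t w - B 0 w) i 0| <= eta * Num.sqrt t) ->
   `|\sum_(i < d) v i * (B t w - B 0 w) i 0 - v j * (B t w - B 0 w) j 0| <= `|v j| / 2 * Num.sqrt t.
  move=> o; rewrite (bigD1 j) //= addrAC subrr add0r.
  apply: le_trans (ler_norm_sum _ _ _) _.
  apply: (@le_trans _ _ (\sum_(i < d | i != j) `|v i| * (eta * Num.sqrt t))).
    by apply: ler_sum => i ij; rewrite normrM ler_wpM2l // o.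
  rewrite -mulr_suml.
  have : \sum_(i < d | i != j) `|v i| <= V by rewrite /V [leRHS](bigD1 j) //= lerDr.
  move=> le; apply: (@le_trans _ _ (V * (eta * Num.sqrt t))).
    by rewrite ler_wpM2r // mulr_ge0 ?ltW.
  by rewrite mulrA ler_wpM2r ?(ltW s0) // mulrC.
have := split_sum _ o1; have := split_sum _ o2.
have := close _ Nw1; have := close _ Nw2.
move: (\sum_(i < d) v i * (B t w1 - B 0 w1) i 0) (\sum_(i < d) v i * (B t w2 - B 0 w2) i 0) => S1 S2.
have jump : 2 * `|v j| * Num.sqrt t <= `|v j * (B t w1 - B 0 w1) j 0 - v j * (B t w2 - B 0 w2) j 0|.
  rewrite -mulrBr normrM [2 * _]mulrC -mulrA ler_wpM2l //.
  apply: le_trans (ler_norm _).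
  by case/andP: j1 => j1 _; case/andP: j2 => _ j2; lra.
move: jump; move: (v j * (B t w1 - B 0 w1) j 0) (v j * (B t w2 - B 0 w2) j 0) => x1 x2 jump c2 c1 h2 h1.
have tri : `|x1 - x2| <= `|S1 - x1| + `|S1 - c| + `|S2 - c| + `|S2 - x2|.
  have -> : x1 - x2 = - (S1 - x1) + (S1 - c) - (S2 - c) + (S2 - x2) by ring.
  rewrite (le_trans (ler_normD _ _)) // lerD2r (le_trans (ler_normB _ _)) // lerD2r.
  by rewrite (le_trans (ler_normD _ _)) // normrN.
have pos : 0 < `|v j| * Num.sqrt t by rewrite mulr_gt0.
lra.
Qed.

End nondegeneracy.

(** * Linear differential equations *)

Section linear_ode.
Context (R : realType).
Local Notation mu := (@lebesgue_measure R).

Lemma continuous_integrable_itv (g : R -> R) (t : R) :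
  {within `[0, +oo[, continuous g} -> mu.-integrable `[0, t] (EFin \o g).
Proof.
move=> cg; apply: continuous_compact_integrable; first exact: segment_compact.
by apply: continuous_subspaceW cg => s /=; rewrite !in_itv /= andbT => /andP[].
Qed.

Lemma monomial_continuous (k : nat) (a : R) : continuous (fun u : R => u ^+ k / a).
Proof. by move=> u; apply: cvgMl; exact: exprn_continuous. Qed.

Lemma Rintegral_monomial (k : nat) (t : R) : 0 <= t ->
  \int[mu]_(u in `[0, t]) (u ^+ k / k`!%:R) = t ^+ k.+1 / k.+1`!%:R.
Proof.
rewrite le_eqVlt => /orP[/eqP <-|t0].
  by rewrite set_itv1 Rintegral_set1 expr0n mul0r.
have dF (u : R) : is_derive u 1 (fun u : R => u ^+ k.+1 / k.+1`!%:R) (u ^+ k / k`!%:R).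
  have -> : (fun u : R => u ^+ k.+1 / k.+1`!%:R) = (k.+1`!%:R)^-1 \*: (fun u : R => u ^+ k.+1).
    by apply/funext => v; rewrite /= mulrC.
  have dX : is_derive u 1 (@GRing.exp R ^~ k.+1) (k.+1%:R * u ^+ k).
    by apply: DeriveDef; [exact: exprn_derivable|rewrite exp_derive [LHS]mulr1].
  apply: is_derive_eq (is_deriveZ _ dX) _.
  rewrite /GRing.scale /= factS natrM.
  have : (k`!%:R : R) != 0 by rewrite pnatr_eq0 -lt0n fact_gt0.
  have : (k.+1%:R : R) != 0 by rewrite pnatr_eq0.
  by move: (k`!%:R) (k.+1%:R) => a b b0 a0; field; rewrite a0 b0.
rewrite /Rintegral (@continuous_FTC2 _ _ (fun u => u ^+ k.+1 / k.+1`!%:R)) //.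
- by rewrite expr0n mul0r sube0.
- by apply: continuous_subspaceT; exact: monomial_continuous.
- have cF := @monomial_continuous k.+1 (k.+1`!%:R).
  split.
  + by move=> u _; apply: (@ex_derive _ _ _ _ _ _ _ (dF u)).
  + by apply: cvg_at_right_filter; exact: cF.
  + by apply: cvg_at_left_filter; exact: cF.
- by move=> u _; rewrite derive1E derive_val.
Qed.

Context (d : nat) (C : 'M[R]_d).

(** The integral form of D' = C D with D(0) = x, which is how the equation arises path by path from
    the difference of two diffusions. *)
Definition ode_solution (x : 'cV[R]_d) (D : R -> 'cV[R]_d) :=
  {within `[0, +oo[, continuous D} /\
  forall t, 0 <= t -> D t = x + \col_i \int[mu]_(s in `[0, t]) ((C *m D s) i 0).

Definition taylor_remainder (x : 'cV[R]_d) (D : R -> 'cV[R]_d) n t : 'cV[R]_d :=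
  D t - \sum_(k < n) (t ^+ k / k`!%:R) *: (C ^+ k *m x).

Lemma taylor_remainderS x D n t : taylor_remainder x D n.+1 t =
  taylor_remainder x D n t - (t ^+ n / n`!%:R) *: (C ^+ n *m x).
Proof. by rewrite /taylor_remainder big_ord_recr /= opprD addrA. Qed.

Lemma taylor_remainder_continuous x (D : R -> 'cV[R]_d) n : {within `[0, +oo[, continuous D} ->
  {within `[0, +oo[, continuous (taylor_remainder x D n)}.
Proof.
move=> cD; elim: n => [|n IH].
  have -> : taylor_remainder x D 0 = D; last exact: cD.
  by apply/funext => t; rewrite /taylor_remainder big_ord0 subr0.
have -> : taylor_remainder x D n.+1 =
    taylor_remainder x D n \- (fun t => (t ^+ n / n`!%:R) *: (C ^+ n *m x)).
  by apply/funext => t; rewrite taylor_remainderS.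
apply: within_continuousB => //; apply: continuous_subspaceT => t.
by apply: cvgZr_tmp; exact: monomial_continuous.
Qed.

Lemma taylor_remainder_coord_continuous x (D : R -> 'cV[R]_d) n i : {within `[0, +oo[, continuous D} ->
  {within `[0, +oo[, continuous (fun s => (C *m taylor_remainder x D n s) i 0)}.
Proof.
move=> /(@taylor_remainder_continuous x _ n) cR; apply: within_continuous_coord => s.
apply: (@continuous_comp _ _ _ (taylor_remainder x D n : subspace _ -> _) (fun v => C *m v)).
  exact: cR.
exact: mulmx_continuous.
Qed.

(** Integrating C times a partial sum of e^(tC) x gives the next partial sum without its constant
    term x, and that term comes from the equation for D. Each remainder is thus the Picard integral
    of the preceding one. *)
Lemma taylor_remainder_integral x D n t i : ode_solution x D -> 0 <= t ->
  taylor_remainder x D n.+1 t i 0 =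
  \int[mu]_(s in `[0, t]) ((C *m taylor_remainder x D n s) i 0).
Proof.
move=> [cD odeD] t0; elim: n => [|n IH].
  rewrite taylor_remainderS /taylor_remainder big_ord0 subr0 expr0 fact0 divr1 scale1r.
  rewrite expr0 -[1]/(1%:M) mul1mx odeD // addrAC subrr add0r mxE.
  by apply: eq_Rintegral => s _; rewrite big_ord0 subr0.
have iR := continuous_integrable_itv t (@taylor_remainder_coord_continuous x _ n i cD).
have iM : mu.-integrable `[0, t] (EFin \o (fun s => (s ^+ n / n`!%:R) * (C ^+ n.+1 *m x) i 0)).
  apply: continuous_integrable_itv; apply: continuous_subspaceT => s.
  by apply: cvgMl; exact: monomial_continuous.
have iM0 : mu.-integrable `[0, t] (EFin \o (fun s => (s ^+ n / n`!%:R))).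
  by apply: continuous_integrable_itv; apply: continuous_subspaceT; exact: monomial_continuous.
have subE (a : R) (u v : 'cV[R]_d) : (u - a *: v) i 0 = u i 0 - a * v i 0 by rewrite !mxE.
rewrite taylor_remainderS subE IH.
transitivity (\int[mu]_(s in `[0, t]) ((C *m taylor_remainder x D n s) i 0
   - (s ^+ n / n`!%:R) * (C ^+ n.+1 *m x) i 0)).
  by rewrite RintegralB // RintegralZr // Rintegral_monomial.
apply: eq_Rintegral => s _; rewrite taylor_remainderS [in RHS]mulmxBr -scalemxAr mulmxA.
by rewrite -[C *m C ^+ n]exprS subE.
Qed.

(** K is the maximum of |D| on [0, t]; each Picard integral contributes a factor d |C| and raises
    s^n / n! to the next monomial. *)
Lemma taylor_remainder_bound x D t : ode_solution x D -> 0 <= t ->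
  exists2 K, 0 <= K & forall n s, 0 <= s -> s <= t ->
    `|taylor_remainder x D n s| <= K * ((d%:R * `|C|) ^+ n * (s ^+ n / n`!%:R)).
Proof.
move=> oD t0; have [cD odeD] := oD.
have cn : {within `[0, t], continuous (fun s => `|D s|)}.
  have cD' : {within `[0, t], continuous D}.
    by apply: continuous_subspaceW cD => s /=; rewrite !in_itv /= andbT => /andP[].
  move=> s; apply: (@continuous_comp _ _ _ (D : subspace _ -> _) (fun v => `|v|)).
    exact: cD'.
  exact: norm_continuous.
have [m _ Hm] := EVT_max t0 cn.
exists `|D m| => // n; elim: n => [|n IH] s s0 st.
  rewrite /taylor_remainder big_ord0 subr0 !expr0 fact0 divr1 !mulr1.
  by apply: Hm; rewrite in_itv /= s0.
set c := d%:R * `|C|.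
have c0 : 0 <= c by rewrite mulr_ge0.
apply: mx_norm_le => [|i j].
  by rewrite !mulr_ge0 ?exprn_ge0 ?invr_ge0.
rewrite (ord1 j) taylor_remainder_integral //.
have iR := continuous_integrable_itv s (@taylor_remainder_coord_continuous x _ n i cD).
apply: le_trans (le_normr_Rintegral _ iR) _ => //.
have iM0 : mu.-integrable `[0, s] (EFin \o (fun s => (s ^+ n / n`!%:R))).
  by apply: continuous_integrable_itv; apply: continuous_subspaceT; exact: monomial_continuous.
apply: (@le_trans _ _ (\int[mu]_(u in `[0, s]) (`|D m| * c ^+ n.+1 * (u ^+ n / n`!%:R)))).
  apply: le_Rintegral => //.
  - exact: integrable_norm.
  - apply: continuous_integrable_itv; apply: continuous_subspaceT => u.
    by apply: cvgMr; exact: monomial_continuous.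
  move=> u /=; rewrite in_itv /= => /andP[u0 us].
  apply: le_trans (mx_coord_le _ _ _) _; apply: le_trans (mx_norm_mulmx _ _) _.
  rewrite -/c (_ : `|D m| * c ^+ n.+1 * _ = c * (`|D m| * (c ^+ n * (u ^+ n / n`!%:R)))).
    by rewrite ler_wpM2l // IH // (le_trans us st).
  by rewrite exprS; ring.
by rewrite RintegralZl // Rintegral_monomial // -mulrA.
Qed.

Lemma taylor_remainder_cvg x D t i : ode_solution x D -> 0 <= t ->
  (\sum_(k < n) (t ^+ k / k`!%:R) * (C ^+ k *m x) i 0) @[n --> \oo] --> D t i 0.
Proof.
move=> oD t0; have [K K0 HK] := taylor_remainder_bound oD t0.
apply/cvgrPdist_le => e e0.
have := @cvg_exp_coeff R (d%:R * `|C| * t).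
move=> /cvgrPdist_le /(_ (e / (K + 1)) (divr_gt0 e0 (ltr_wpDl K0 ltr01))).
apply: filterS => n; rewrite sub0r normrN => H.
have -> : D t i 0 - \sum_(k < n) (t ^+ k / k`!%:R) * (C ^+ k *m x) i 0 =
    taylor_remainder x D n t i 0.
  rewrite /taylor_remainder [RHS]mxE [in RHS]mxE summxE; congr (_ - _).
  by apply: eq_bigr => k _; rewrite [RHS]mxE.
apply: le_trans (mx_coord_le _ _ _) _.
apply: le_trans (HK n t t0 (lexx t)) _.
rewrite mulrA.
have -> : K * (d%:R * `|C|) ^+ n * (t ^+ n / n`!%:R) = K * exp_coeff (d%:R * `|C| * t) n.
  by rewrite /exp_coeff /= [(d%:R * `|C| * t) ^+ n]exprMn !mulrA.
apply: (@le_trans _ _ ((K + 1) * `|exp_coeff (d%:R * `|C| * t) n|)).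
  by rewrite ler_pM ?lerDl ?ler_norm // exp_coeff_ge0 // !mulr_ge0.
by rewrite mulrC -ler_pdivlMr ?ltr_wpDl.
Qed.

End linear_ode.

Section expmx.
Context (R : realType).

Lemma cvg_mx (T : Type) (F : set_system T) (FF : Filter F) m n (f : T -> 'M[R]_(m, n))
    (L : 'M[R]_(m, n)) :
  (forall i j, (fun x => f x i j) @ F --> L i j) -> f @ F --> L.
Proof.
move=> h; apply/cvgrPdist_le => e e0.
have : \forall x \near F, forall ij : 'I_m * 'I_n, `|L ij.1 ij.2 - f x ij.1 ij.2| <= e.
  by apply: filter_forall => -[i j]; move: (h i j) => /cvgrPdist_le; apply.
apply: filterS => x H; apply: mx_norm_le (ltW e0) _ => i j.
by have := H (i, j); rewrite !mxE.
Qed.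

Context (d : nat) (C : 'M[R]_d).

Lemma exprZ_mx (t : R) k : (t *: C) ^+ k = t ^+ k *: C ^+ k.
Proof.
elim: k => [|k IH]; first by rewrite !expr0 scale1r.
have mulE (A A' : 'M[R]_d) : A * A' = A *m A' by [].
by rewrite !exprS IH !mulE -scalemxAl -scalemxAr scalerA.
Qed.

Lemma series_expmx_mulE (t : R) (x : 'cV[R]_d) n i :
  (series (fun k => (k`!%:R)^-1 *: (t *: C) ^+ k) n *m x) i 0 =
  \sum_(k < n) (t ^+ k / k`!%:R) * (C ^+ k *m x) i 0.
Proof.
rewrite /series /= big_mkord mulmx_suml summxE; apply: eq_bigr => k _.
by rewrite exprZ_mx scalerA -scalemxAl mxE mulrC [in RHS]mulrC [(k`!%:R)^-1 * _]mulrC.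
Qed.

(* The solutions issued from the basis vectors also give the convergence of the exponential
   series, which [expmx] needs in order not to be a junk limit. *)
Lemma ode_solution_expmx (x : 'cV[R]_d) (D : R -> 'cV[R]_d) (t : R) :
  (forall j, exists E, ode_solution C (delta_mx j 0) E) ->
  ode_solution C x D -> 0 <= t -> D t = expmx (t *: C) *m x.
Proof.
move=> basis oD t0.
have [E oE] := choice basis.
pose L : 'M[R]_d := \matrix_(i, j) E j t i 0.
have cL : series (fun k => (k`!%:R)^-1 *: (t *: C) ^+ k) @ \oo --> L.
  apply: cvg_mx => i j; rewrite mxE.
  have := @taylor_remainder_cvg _ _ _ _ _ t i (oE j) t0.
  rewrite (_ : (fun n => \sum_(k < n) _) =
      (fun n => (series (fun k => (k`!%:R)^-1 *: (t *: C) ^+ k) n) i j)) //.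
  by apply/funext => n; rewrite -series_expmx_mulE -colE mxE.
have -> : expmx (t *: C) = L by apply/cvg_lim.
apply/matrixP => i j; rewrite (ord1 j).
pose S n := (series (fun k => (k`!%:R)^-1 *: (t *: C) ^+ k) n *m x) i 0.
have c1 : S @ \oo --> D t i 0.
  rewrite (_ : S = (fun n => \sum_(k < n) (t ^+ k / k`!%:R) * (C ^+ k *m x) i 0)); last first.
    by apply/funext => n; exact: series_expmx_mulE.
  exact: taylor_remainder_cvg.
have cm : continuous (fun M : 'M[R]_d => (M *m x) i 0).
  apply: (@dist_le_continuous _ _ _ _ (d%:R * `|x|)) => A A'.
  have -> : (A *m x) i 0 - (A' *m x) i 0 = ((A - A') *m x) i 0.
    by have subE (u v : 'cV[R]_d) : (u - v) i 0 = u i 0 - v i 0; rewrite ?mulmxBl ?subE // !mxE.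
  by apply: le_trans (mx_coord_le _ _ _) _; rewrite mulrAC mx_norm_mulmx.
have c2 : S @ \oo --> (L *m x) i 0 := cvg_comp _ _ cL (cm L).
by rewrite -(cvg_lim (@Rhausdorff R) c1) (cvg_lim (@Rhausdorff R) c2).
Qed.

End expmx.

(** * Functions with continuous partial derivatives *)

Section partial_derivatives.
Context (R : realType) (d : nat).
Implicit Types (h : 'cV[R]_d -> R) (x y k : 'cV[R]_d).

Lemma is_derive_line h y (e : 'cV[R]_d) (s : R) : (forall z, derivable h z e) ->
  is_derive s 1 (fun u : R => h (y + u *: e)) ('D_e h (y + s *: e)).
Proof.
move=> dh.
have E : (fun a : R => a^-1 *: (h (y + (a *: 1 + s) *: e) - h (y + s *: e))) =
    (fun a : R => a^-1 *: (h (a *: e + (y + s *: e)) - h (y + s *: e))).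
  apply/funext => a; congr (_ *: (h _ - _)).
  by rewrite scalerDl addrCA [a *: 1]mulr1.
apply: DeriveDef; last by rewrite /derive /= E.
by have := dh (y + s *: e); rewrite /derivable /= E.
Qed.

Lemma coordinate_MVT h y (e : 'cV[R]_d) (a : R) : (forall z, derivable h z e) ->
  exists2 s : R, `|s| <= `|a| & h (y + a *: e) - h y = 'D_e h (y + s *: e) * a.
Proof.
move=> dh; pose phi (u : R) := h (y + u *: e).
have dphi (u : R) : is_derive u 1 phi ('D_e h (y + u *: e)) by exact: is_derive_line.
have cphi A : {within A, continuous phi}.
  apply: continuous_subspaceT => u; apply: differentiable_continuous.
  by apply/derivable1_diffP; case: (dphi u).
have phi0 : h y = phi 0 by rewrite /phi scale0r addr0.
have [a0|a0] := leP 0 a.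
  have [s] := @MVT_segment R phi (fun u => 'D_e h (y + u *: e)) 0 a a0 (fun u _ => dphi u) (@cphi _).
  rewrite in_itv /= subr0 => /andP[s0 sa] E; exists s; last by rewrite phi0.
  by rewrite !ger0_norm.
have [s] := @MVT_segment R phi (fun u => 'D_e h (y + u *: e)) a 0 (ltW a0) (fun u _ => dphi u) (@cphi _).
rewrite in_itv /= sub0r => /andP[sa s0] E; exists s.
  by rewrite (ltr0_norm a0) ler0_norm // lerN2.
by rewrite phi0 -[LHS]opprB E mulrN opprK.
Qed.

(** The coordinates of k are added one at a time, with the one-variable mean value theorem on each
    segment. In the maximum norm all intermediate points stay within |k| of x. *)
Lemma multivariate_MVT h x k :
  (forall j : 'I_d, forall z, derivable h z (delta_mx j 0)) ->
  exists xi : 'I_d -> 'cV[R]_d, (forall j, `|xi j - x| <= `|k|) /\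
    h (x + k) - h x = \sum_(j < d) 'D_(delta_mx j 0) h (xi j) * k j 0.
Proof.
move=> dh.
pose z (m : nat) : 'cV[R]_d := \col_i (if (i < m)%N then k i 0 else 0).
have zS (j : 'I_d) : z j.+1 = z j + k j 0 *: delta_mx j 0.
  apply/matrixP => i l; rewrite (ord1 l) !mxE ltnS leq_eqVlt eqxx andbT.
  by have [->|ij] := eqVneq i j; [rewrite ltnn eqxx add0r mulr1|rewrite val_eqE (negbTE ij) mulr0 addr0].
have step (j : 'I_d) : exists xij : 'cV[R]_d, `|xij - x| <= `|k| /\
    h (x + z j.+1) - h (x + z j) = 'D_(delta_mx j 0) h xij * k j 0.
  have [s sk E] := coordinate_MVT (x + z j) (k j 0) (dh j).
  exists (x + z j + s *: delta_mx j 0); split; last by rewrite zS addrA.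
  rewrite -[x + z j + _]addrA [x + (_ + _)]addrC addrK; apply: mx_norm_le => // i l.
  rewrite (ord1 l) !mxE eqxx andbT.
  have [->|ij] := eqVneq i j.
    by rewrite ltnn add0r mulr1 (le_trans sk) // mx_coord_le.
  rewrite mulr0 addr0; case: ifP => _; first exact: mx_coord_le.
  by rewrite normr0.
have [xi Hxi] := choice step.
exists xi; split; first by move=> j; case: (Hxi j).
have -> : h (x + k) - h x = \sum_(j < d) (h (x + z j.+1) - h (x + z j)).
  rewrite -(big_mkord xpredT (fun j => h (x + z j.+1) - h (x + z j))) telescope_sumr //.
  congr (h (_ + _) - h _).
    by apply/matrixP => i l; rewrite (ord1 l) !mxE ltn_ord.
  have -> : z 0%N = 0 by apply/matrixP => i l; rewrite !mxE.
  by rewrite addr0.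
by apply: eq_bigr => j _; case: (Hxi j).
Qed.

(** Continuity of the partial derivatives allows the intermediate points of the mean value formula
    to be replaced by x, at a cost of e / (d + 1) per coordinate. *)
Lemma first_order_expansion h x (e : R) :
  (forall j : 'I_d, forall z, derivable h z (delta_mx j 0)) ->
  (forall j : 'I_d, continuous (fun z => 'D_(delta_mx j 0) h z)) -> 0 < e ->
  exists2 rho, 0 < rho & forall k, `|k| <= rho ->
    `|h (x + k) - h x - \sum_(j < d) 'D_(delta_mx j 0) h x * k j 0| <= e * `|k|.
Proof.
move=> dh ch e0.
have e1 : 0 < e / d.+1%:R by rewrite divr_gt0.
have : \forall z \near x, forall j : 'I_d,
    `|'D_(delta_mx j 0) h x - 'D_(delta_mx j 0) h z| <= e / d.+1%:R.
  apply: (@filter_forall _ _ (fun j z => `|'D_(delta_mx j 0) h x - 'D_(delta_mx j 0) h z| <= e / d.+1%:R)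
    (nbhs x) _) => j.
  by move: (ch j x) => /cvgrPdist_le; apply.
move=> /nbhs_ballP[rho /= rho0 H].
exists (rho / 2) => [|k kr]; first by rewrite divr_gt0.
have [xi [xik ->]] := multivariate_MVT x k dh.
rewrite -sumrB; apply: le_trans (ler_norm_sum _ _ _) _.
apply: (@le_trans _ _ (\sum_(j < d) (e / d.+1%:R * `|k|))).
  apply: ler_sum => j _; rewrite -mulrBl normrM ler_pM ?mx_coord_le //.
  rewrite distrC; apply: (H (xi j)).
  rewrite -ball_normE /= distrC (le_lt_trans (xik j)) // (le_lt_trans kr) //.
  by rewrite ltr_pdivrMr // mulr_natr mulr2n ltrDl.
rewrite sumr_const card_ord -[leLHS]mulr_natr mulrAC ler_wpM2r //.
rewrite mulrAC ler_pdivrMr // ler_pM2l // ler_nat; exact: leqnSn.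
Qed.

End partial_derivatives.

(** * Small-time behaviour of solutions *)

Lemma lipschitzP (R : realType) (V W : normedModType R) (f : V -> W) : lipschitz f ->
  exists2 L, 0 <= L & forall x y, `|f x - f y| <= L * `|x - y|.
Proof.
move=> [L0 [_ h]]; exists (`|L0| + 1); first by rewrite addr_ge0.
move=> x y; have Lt : L0 < `|L0| + 1 by rewrite (le_lt_trans (ler_norm _)) // ltrDl.
by apply: (h _ Lt (x, y)).
Qed.

Section exit_time.
Context (R : realType) (d : nat) (disp : measure_display) (T : measurableType disp)
  (P : probability T R).

(** Continuity at 0 becomes uniform off a small event: the events of leaving the ball at some
    rational time before 1/(n+1) decrease to a null set. Rational times keep these events
    measurable. *)
Lemma exit_event (X : R -> T -> 'cV[R]_d) (x : 'cV[R]_d) (rho p : R) :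
  (forall t i, 0 <= t -> measurable_fun setT (fun w => X t w i 0)) ->
  continuous_paths X -> {ae P, forall w, X 0 w = x} -> 0 < rho -> 0 < p ->
  exists delta N, [/\ 0 < delta, measurable N, (P N <= p%:E)%E &
    forall w, ~ N w -> forall s, 0 <= s -> s < delta -> `|X s w - x| <= rho].
Proof.
move=> mX cX X0 rho0 p0.
pose q (k : nat) : R := if unpickle k is Some y then Num.max 0 (ratr y) else 0.
have q0 k : 0 <= q k by rewrite /q; case: unpickle => // y; rewrite le_max lexx.
pose A k := [set w | rho < `|X (q k) w - x|].
have mA k : measurable (A k).
  have mn : measurable_fun setT (fun w => `|X (q k) w - x|).
    apply: measurable_mx_norm => i j; rewrite (ord1 j).
    have -> : (fun w => (X (q k) w - x) i 0) = (fun w => X (q k) w i 0 - x i 0).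
      by apply/funext => w; rewrite !mxE.
    by apply: measurable_funB => //; exact: mX.
  exact: measurable_gt_level.
pose dl (n : nat) : R := n.+1%:R^-1.
pose N n := \bigcup_(k in [set k | q k < dl n]) A k.
have mN n : measurable (N n) by apply: bigcup_measurable => k _; exact: mA.
have Ndec : nonincreasing_seq N.
  move=> m n mn; apply/subsetPset => w [k /= qk Ak]; exists k => //=.
  by apply: lt_le_trans qk _; rewrite lef_pV2 ?posrE // ler_nat.
have PN0 : P (\bigcap_n N n) = 0%E.
  have [Z [mZ PZ XZ]] := X0.
  apply/eqP; rewrite eq_le measure_ge0 andbT -PZ; apply: le_measure; rewrite ?inE //.
    exact: bigcapT_measurable.
  move=> w Nw; apply: XZ => /= Xw.
  have D0 : `[0, +oo[%classic (0 : R) by rewrite /= in_itv /= lexx.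
  have [de de0 H] := within_continuous_dist (cX w) D0 rho0.
  have [n] := ltr_add_invr de0; rewrite add0r => nde.
  have [k /= qk Ak] := Nw n I.
  have Dk : `[0, +oo[%classic (q k) by rewrite /= in_itv /= q0.
  have := H _ Dk; rewrite sub0r normrN ger0_norm // Xw distrC => /(_ (lt_trans qk nde)).
  by move=> lt; have := lt_trans Ak lt; rewrite ltxx.
have cN : P (N n) @[n --> \oo] --> 0%E.
  rewrite -PN0; apply: nonincreasing_cvg_mu => //.
  - by rewrite (le_lt_trans (probability_le1 _ _)) // ltry.
  - exact: bigcapT_measurable.
have /fine_cvgP[Nfin Ncvg] := cN.
have : \forall n \near \oo, fine (P (N n)) < p by apply: (cvgr_lt (0 : R)) p0.
have Nfin' : \forall n \near \oo, P (N n) \is a fin_num by [].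
move=> /(filterI Nfin') /= /filter_ex [n [fin lt]].
exists (dl n), (N n); split => //.
- by rewrite invr_gt0.
- by rewrite -(fineK fin) lee_fin ltW.
move=> w Nw s s0 sd; rewrite leNgt; apply/negP => lts.
(* If the path is outside the ball at a real time s, the overshoot e leaves room for a slightly
   later rational time that is also outside. *)
pose e := `|X s w - x| - rho.
have e0 : 0 < e by rewrite subr_gt0.
have Ds : `[0, +oo[%classic s by rewrite /= in_itv /= s0.
have [de de0 H] := within_continuous_dist (cX w) Ds e0.
have [y] : exists y : rat, ratr y \in `]s, Num.min (dl n) (s + de)[.
  by apply: rat_in_itvoo; rewrite lt_min sd ltrDl.
rewrite in_itv /= lt_min => /andP[sy /andP[yd yde]].
have qy : q (pickle y) = ratr y.
  by rewrite /q pickleK; apply/max_idPr; rewrite (le_trans s0) // ltW.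
apply: Nw; exists (pickle y); rewrite /= ?qy // /A /= qy.
have Dy : `[0, +oo[%classic (ratr y : R) by rewrite /= in_itv /= (le_trans s0) // ltW.
have := H _ Dy; rewrite distrC ger0_norm ?subr_ge0 ?(ltW sy) // ltrBlDl yde => /(_ isT) lt2.
have : `|X s w - x| <= `|X s w - X (ratr y) w| + `|X (ratr y) w - x|.
  by rewrite -[X s w - x](subrKA (X (ratr y) w)) ler_normD.
by move: lt2; rewrite /e => ? ?; lra.
Qed.

Lemma drift_integral_le (b : 'cV[R]_d -> 'cV[R]_d) (X : R -> T -> 'cV[R]_d) t w c :
  continuous b -> continuous_paths X -> 0 <= t ->
  (forall s, 0 <= s -> s <= t -> `|b (X s w)| <= c) ->
  `|drift_integral b X t w| <= c * t.
Proof.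
move=> cb cX t0 H.
have c0 : 0 <= c by apply: le_trans (H 0 (lexx 0) t0).
apply: mx_norm_le => [|i j]; first by rewrite mulr_ge0.
rewrite mxE.
have cbX : {within `[0, +oo[, continuous (fun s => b (X s w) i 0)}.
  apply: within_continuous_coord => s.
  by apply: (@continuous_comp _ _ _ (X ^~ w : subspace _ -> _) b); [exact: cX|exact: cb].
have ib := continuous_integrable_itv t cbX.
apply: le_trans (le_normr_Rintegral _ ib) _ => //.
apply: (@le_trans _ _ (\int[lebesgue_measure]_(s in `[0, t]) c)).
  apply: le_Rintegral => //.
  - exact: integrable_norm.
  - by apply: continuous_integrable_itv; apply: continuous_subspaceT => s; exact: cvg_cst.
  - move=> s /=; rewrite in_itv /= => /andP[s0 st].
    by apply: le_trans (mx_coord_le _ _ _) (H s s0 st).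
rewrite Rintegral_cst //= lebesgue_measure_itv /= lte_fin.
by move: t0; rewrite le_eqVlt => /orP[/eqP <-|->] /=; rewrite ?ltxx ?mulr0 //= subr0.
Qed.

End exit_time.

Section small_time.
Context (R : realType) (d : nat) (disp : measure_display) (T : measurableType disp)
  (P : probability T R) (F : R -> set (set T)).
Hypothesis F_filtration : filtration F.
Variable B : R -> T -> 'cV[R]_d.
Hypothesis B_brownian : brownian_motion P F B.
Variables (sigma : 'cV[R]_d -> 'M[R]_d) (b : 'cV[R]_d -> 'cV[R]_d).
Hypotheses (sigma_lipschitz : lipschitz sigma) (b_lipschitz : lipschitz b).

Lemma small_time_expansion x (X : R -> T -> 'cV[R]_d) (e p : R) :
  strong_solution P F B sigma b x X -> 0 < e -> 0 < p ->
  exists2 delta, 0 < delta & forall t, 0 < t -> t < delta ->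
    exists N, [/\ measurable N, (P N <= p%:E)%E &
      forall w, ~ N w -> `|X t w - x - sigma x *m (B t w - B 0 w)| <= e * Num.sqrt t].
Proof.
move=> [aX cX X0 [I ito eqX]] e0 p0.
have [Ls Ls0 Hs] := lipschitzP sigma_lipschitz.
have [Lb Lb0 Hb] := lipschitzP b_lipschitz.
have cs := dist_le_continuous Hs; have cb := dist_le_continuous Hb.
pose D2 : R := d.+1%:R ^+ 2.
have D20 : 0 < D2 by rewrite exprn_gt0.
pose dd : R := (d * d)%:R.
have dd0 : 0 <= dd by [].
(* A rho^2 is the variance term of [ito_close] for the radius Ls * rho and the threshold e/2 * sqrt
   t, in which t cancels; 256 = 64 * 4. The choice of rho makes it at most p/4, and the exit event
   gets probability p / (4 (dd + 1)) because that bound counts it dd times. *)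
pose A := dd * (256 * D2 * Ls ^+ 2 / e ^+ 2).
have A0 : 0 <= A by rewrite /A !mulr_ge0 ?invr_ge0 ?exprn_ge0 // ltW.
have A1 : 0 < 4 * (A + 1) by rewrite mulr_gt0 // ltr_wpDl.
pose rho := Num.sqrt (p / (4 * (A + 1))).
have rho0 : 0 < rho by rewrite sqrtr_gt0 divr_gt0.
have rho2 : rho ^+ 2 = p / (4 * (A + 1)) by rewrite sqr_sqrtr // ltW // divr_gt0.
have p1 : 0 < p / (4 * (dd + 1)) by rewrite divr_gt0 // mulr_gt0 // ltr_wpDl.
have [dl [N0 [dl0 mN0 PN0 HN0]]] := exit_event
  (fun t i t0 => adapted_measurable F_filtration i aX t0) cX X0 rho0 p1.
pose c := `|b x| + Lb * rho.
have c0 : 0 <= c by rewrite addr_ge0 // mulr_ge0 // ltW.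
(* c bounds |b| along the path before it exits, so the drift is at most c t = c sqrt t * sqrt t,
   which is below e/2 * sqrt t once sqrt t < u. *)
pose u := e / (2 * (c + 1)).
have c1 : 0 < 2 * (c + 1) by rewrite mulr_gt0 // ltr_wpDl.
have u0 : 0 < u by rewrite divr_gt0.
exists (Num.min dl (u ^+ 2)); first by rewrite lt_min dl0 exprn_gt0.
move=> t t0; rewrite lt_min => /andP[tdl tu].
have s0 : 0 < Num.sqrt t by rewrite sqrtr_gt0.
have s2 : Num.sqrt t ^+ 2 = t by rewrite sqr_sqrtr // ltW.
have su : Num.sqrt t < u.
  by rewrite -(ltr_pXn2r (n := 2)) ?nnegrE ?s2 // ltW.
pose E := [set w | e / 2 * Num.sqrt t <= `|I t w - sigma x *m (B t w - B 0 w)|].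
have aI : adapted F I by case: ito.
have mE : measurable E.
  have mres := ito_residual_measurable F_filtration B_brownian (sigma x) aI (ltW t0).
  exact: measurable_ge_level.
have HX w s : ~ N0 w -> 0 <= s -> s <= t -> `|X s w - x| <= rho.
  by move=> Nw s0' st; apply: HN0 => //; exact: le_lt_trans st tdl.
have csX w : {within `[0, +oo[, continuous (fun s => sigma (X s w))}.
  by move=> s; apply: (@continuous_comp _ _ _ (X ^~ w : subspace _ -> _) sigma);
    [exact: cX|exact: cs].
have PE : (P E <= (p / 2)%:E)%E.
  have es0 : 0 < e / 2 * Num.sqrt t by rewrite mulr_gt0 // divr_gt0.
  have KM w s : ~ N0 w -> 0 <= s -> s <= t -> `|sigma (X s w) - sigma x| <= Ls * rho.
    by move=> Nw s0' st; apply: le_trans (Hs _ _) _; rewrite ler_wpM2l // HX.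
  apply: le_trans (ito_close F_filtration B_brownian ito (ltW t0) csX mN0 KM es0) _.
  rewrite lee_fin -/dd -/D2.
  have fN : fine (P N0) <= p / (4 * (dd + 1)).
    by rewrite -lee_fin fineK // fin_num_measure.
  have -> : dd * (fine (P N0) + 64 * D2 * ((Ls * rho) ^+ 2 * t) / (e / 2 * Num.sqrt t) ^+ 2) =
     dd * fine (P N0) + A * rho ^+ 2.
    rewrite mulrDr; congr (_ + _); rewrite /A exprMn [(e / 2 * _) ^+ 2]exprMn s2.
    by field; rewrite !gt_eqF.
  have h1 : dd * fine (P N0) <= p / 4.
    apply: le_trans (ler_wpM2l dd0 fN) _.
    rewrite mulrA ler_pdivrMr ?mulr_gt0 ?ltr_wpDl //.
    have -> : p / 4 * (4 * (dd + 1)) = dd * p + p by field.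
    by rewrite lerDl ltW.
  have h2 : A * rho ^+ 2 <= p / 4.
    rewrite rho2 mulrA ler_pdivrMr //.
    have -> : p / 4 * (4 * (A + 1)) = A * p + p by field.
    by rewrite lerDl ltW.
  by move: h1 h2; move: (dd * _) (A * _) => ? ? ? ?; lra.
have [Z [mZ PZ HZ]] := eqX.
exists (N0 `|` E `|` Z); split.
- by apply: measurableU => //; exact: measurableU.
- apply: le_trans (measureU2 _ _ _) _ => //; first exact: measurableU.
  have PZ0 : (P Z <= 0)%E by rewrite -PZ; exact: lexx.
  apply: le_trans (leeD (lexx _) PZ0) _; rewrite adde0.
  apply: le_trans (measureU2 _ _ _) _ => //.
  apply: (@le_trans _ _ ((p / (4 * (dd + 1)))%:E + (p / 2)%:E)%E); first exact: leeD.
  rewrite -EFinD lee_fin.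
  have : p / (4 * (dd + 1)) <= p / 4.
    by rewrite ler_pM2l // lef_pV2 ?posrE // ?mulr_gt0 ?ltr_wpDl // ler_peMr // lerDr.
  by move: (p / (4 * _)) => ? ?; lra.
move=> w /not_orP[/not_orP[N0w Ew] Zw].
have Xw : X t w = x + I t w + drift_integral b X t w.
  by apply: contrapT => bad; apply: Zw; apply: HZ => /= H; apply: bad; apply: H; exact: ltW.
have Idist : `|I t w - sigma x *m (B t w - B 0 w)| <= e / 2 * Num.sqrt t.
  by rewrite leNgt; apply/negP => h; apply: Ew; exact: ltW.
have drift : `|drift_integral b X t w| <= e / 2 * Num.sqrt t.
  apply: (@le_trans _ _ (c * t)).
    apply: drift_integral_le => //; first exact: ltW.
    move=> s s0' st; rewrite -[b (X s w)](subrK (b x)) addrC /c.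
    apply: le_trans (ler_normD _ _) _; rewrite lerD2l.
    by apply: le_trans (Hb _ _) _; rewrite ler_wpM2l // HX.
  rewrite -{1}s2 expr2 mulrA ler_wpM2r ?(ltW s0) //.
  apply: (@le_trans _ _ ((c + 1) * u)).
    by rewrite ler_pM // ?lerDl // ltW.
  by rewrite le_eqVlt; apply/orP; left; apply/eqP; rewrite /u; field; rewrite gt_eqF // ltr_wpDl.
have -> : X t w - x - sigma x *m (B t w - B 0 w) =
    (I t w - sigma x *m (B t w - B 0 w)) + drift_integral b X t w.
  rewrite Xw; move: (sigma x *m _) (I t w) (drift_integral _ _ _ _) => v1 v2 v3.
  by apply/matrixP => i j; rewrite !mxE; ring.
apply: le_trans (ler_normD _ _) _.
by rewrite [in leRHS](splitr e) mulrDl lerD.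
Qed.

End small_time.

(** * Consequences of deterministic dependence *)

Section events.
Context (disp : measure_display) (T : measurableType disp) (R : realType)
  (P : probability T R).

Lemma ae_exists (Q : T -> Prop) : {ae P, forall w, Q w} -> exists w, Q w.
Proof.
move=> [Z [mZ PZ QZ]]; apply: contrapT => /forallNP nQ.
have ZT : Z = setT by apply/seteqP; split => // w _; apply: QZ; exact: nQ.
have P1 : (P setT = 1)%E by exact: probability_setT.
have P0 : (P setT = 0)%E by rewrite -[in LHS]ZT.
by move: P1; rewrite P0 => /esym /eqP; rewrite onee_eq0.
Qed.

Lemma ae_event (Q : T -> Prop) (p : R) : 0 < p -> {ae P, forall w, Q w} ->
  exists N, [/\ measurable N, (P N <= p%:E)%E & forall w, ~ N w -> Q w].
Proof.
move=> p0 [Z [mZ PZ QZ]]; exists Z; split => //.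
  by have PZ0 : (P Z <= 0)%E by [rewrite -PZ; exact: lexx]; rewrite (le_trans PZ0) // lee_fin ltW.
by move=> w Zw; apply: contrapT => nQ; apply: Zw; exact: QZ.
Qed.

Lemma event_union (N1 N2 : set T) (p1 p2 p : R) :
  measurable N1 -> (P N1 <= p1%:E)%E -> measurable N2 -> (P N2 <= p2%:E)%E ->
  p1 + p2 <= p ->
  measurable (N1 `|` N2) /\ (P (N1 `|` N2) <= p%:E)%E.
Proof.
move=> m1 P1 m2 P2 pp; split; first exact: measurableU.
apply: le_trans (measureU2 _ m1 m2) _; apply: le_trans (leeD P1 P2) _.
by rewrite -EFinD lee_fin.
Qed.

End events.

Section deterministic_dependence.
Context (R : realType) (d : nat) (disp : measure_display) (T : measurableType disp)
  (P : probability T R) (F : R -> set (set T)).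
Hypothesis F_filtration : filtration F.
Variable B : R -> T -> 'cV[R]_d.
Hypothesis B_brownian : brownian_motion P F B.
Variables (sigma : 'cV[R]_d -> 'M[R]_d) (b : 'cV[R]_d -> 'cV[R]_d).
Hypotheses (sigma_lipschitz : lipschitz sigma) (b_lipschitz : lipschitz b).
Variable X : 'cV[R]_d -> R -> T -> 'cV[R]_d.
Hypothesis X_solution : forall x, strong_solution P F B sigma b x (X x).

Let cb : continuous b.
Proof. by have [L _ H] := lipschitzP b_lipschitz; exact: dist_le_continuous H. Qed.

Let cX x : continuous_paths (X x).
Proof. by case: (X_solution x). Qed.

Lemma drift_path_continuous x w i : {within `[0, +oo[, continuous (fun s => b (X x s w) i 0)}.
Proof.
apply: within_continuous_coord => s.
by apply: (@continuous_comp _ _ _ (X x ^~ w : subspace _ -> _) b); [exact: cX|exact: cb].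
Qed.

Lemma brownian_tight (p : R) : 0 < p -> exists2 K : R, 0 < K & forall t, 0 < t ->
  exists N, [/\ measurable N, (P N <= p%:E)%E &
    forall w, ~ N w -> `|B t w - B 0 w| <= K * Num.sqrt t].
Proof.
move=> p0; pose K := Num.sqrt (8 * d.+1%:R / p).
have Kp : 0 < 8 * d.+1%:R / p by rewrite divr_gt0 // mulr_gt0.
have K0 : 0 < K by rewrite sqrtr_gt0.
exists K => // t t0; have s0 : 0 < Num.sqrt t by rewrite sqrtr_gt0.
have e0 : 0 < K * Num.sqrt t by rewrite mulr_gt0.
pose E (j : 'I_d) := [set w | K * Num.sqrt t <= `|B t w j 0 - B 0 w j 0|].
have mE j : measurable (E j).
  apply: measurable_ge_level; apply: measurableT_comp => //.
  exact: (increment_measurable F_filtration B_brownian j (lexx 0) (ltW t0)).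
have PE j : (P (E j) <= (p / d.+1%:R)%:E)%E.
  (* Chebyshev for a single increment, as a one-step integral with coefficient 1: its weighted sum
     of squares is exactly 8 t, so the event of exceeding 8 t is empty, and K is chosen to make 8 t
     / (K^2 t) equal p / (d + 1). *)
  pose tau (k : nat) : R := if k is 0%N then 0 else t.
  have tau0 k : 0 <= tau k by case: k => //= _; exact: ltW.
  have tauS k : tau k <= tau k.+1 by case: k => //=; exact: ltW.
  have [sF _ _] := F_filtration.
  have bounded1 (k : nat) : exists M : R, forall w : T, `|1 : R| <= M.
    by exists 1 => w; rewrite normr1.
  have t8 : 0 <= 8 * t by rewrite mulr_ge0 // ltW.
  have := @discrete_integral_tail _ _ _ _ P F F_filtration B B_brownian tau (fun _ _ => 1) j 1
    (8 * t) (K * Num.sqrt t) tau0 tauS (fun k => gmeasurable_cst (sF _ (tau0 k)) 1)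
    bounded1 t8 e0.
  have -> : [set w | (8 * t < \sum_(k < 1) 1 ^+ 2 * (8 * (tau k.+1 - tau k)))%R] = set0 :> set T.
    apply/seteqP; split => w //=.
    by rewrite big_ord1 expr1n mul1r /= subr0 ltxx.
  rewrite measure0 add0e.
  have -> : [set w | (K * Num.sqrt t <= `|\sum_(k < 1) 1 * (B (tau k.+1) w j 0 - B (tau k) w j 0)|)%R] = E j.
    by apply/seteqP; split => w /=; rewrite big_ord1 mul1r.
  move/le_trans; apply; rewrite lee_fin exprMn !sqr_sqrtr; [|exact: ltW|exact: ltW].
  rewrite le_eqVlt; apply/orP; left; apply/eqP.
  have : (0 : R) < d.+1%:R by [].
  by move: (d.+1%:R) => q q0; field; rewrite !gt_eqF.
have [mU PU] := measure_exists_le P mE.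
exists [set w | exists j, E j w]; split => //.
  apply: le_trans PU _; apply: (@le_trans _ _ (\sum_(j < d) (p / d.+1%:R)%:E)%E).
    by apply: lee_sum => j _; exact: PE.
  rewrite sumEFin lee_fin sumr_const card_ord -[leLHS]mulr_natr mulrAC ler_pdivrMr //.
  by rewrite ler_pM2l // ler_nat leqnSn.
move=> w nE; apply: mx_norm_le => [|i j]; first exact: ltW.
rewrite (ord1 j) !mxE leNgt; apply/negP => lt; apply: nE; exists i; exact: ltW.
Qed.

Lemma sigma_constant (f : R -> 'cV[R]_d -> 'cV[R]_d) x :
  {ae P, forall w, forall t, 0 <= t -> X x t w = f t x + X 0 t w} ->
  sigma x = sigma 0.
Proof.
move=> Xf; apply/matrixP => i j; apply/eqP; rewrite -subr_eq0; apply/eqP.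
apply: (brownian_form_eq0 F_filtration B_brownian (v := fun j => sigma x i j - sigma 0 i j)).
move=> e p e0 p0.
have e2 : 0 < e / 2 by rewrite divr_gt0.
have p3 : 0 < p / 3 by rewrite divr_gt0.
have [d1 d10 H1] := small_time_expansion F_filtration B_brownian sigma_lipschitz b_lipschitz
  (X_solution x) e2 p3.
have [d2 d20 H2] := small_time_expansion F_filtration B_brownian sigma_lipschitz b_lipschitz
  (X_solution 0) e2 p3.
pose t := Num.min d1 d2 / 2.
have m0 : 0 < Num.min d1 d2 by rewrite lt_min d10.
have t0 : 0 < t by rewrite divr_gt0.
have tm : t < Num.min d1 d2 by rewrite /t; lra.
move: (tm); rewrite lt_min => /andP[td1 td2].
have [N1 [mN1 PN1 HN1]] := H1 t t0 td1.
have [N2 [mN2 PN2 HN2]] := H2 t t0 td2.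
have [N3 [mN3 PN3 HN3]] := ae_event p3 Xf.
have [m12 P12] := event_union mN1 PN1 mN2 PN2 (lexx _).
have [m123 P123] : measurable (N1 `|` N2 `|` N3) /\ (P (N1 `|` N2 `|` N3) <= p%:E)%E.
  by apply: event_union m12 P12 mN3 PN3 _; lra.
(* The deterministic center is entry i of f(t, x) - x; what remains is the difference of the two
   expansion errors, each at most e/2 * sqrt t. *)
exists t, ((f t x - x) i 0), (N1 `|` N2 `|` N3); split => // w.
move=> /not_orP[/not_orP[/HN1 h1 /HN2 h2] /HN3 h3].
pose E1 := X x t w - x - sigma x *m (B t w - B 0 w).
pose E2 := X 0 t w - 0 - sigma 0 *m (B t w - B 0 w).
have -> : \sum_(k < d) (sigma x i k - sigma 0 i k) * (B t w - B 0 w) k 0 - (f t x - x) i 0 =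
   - E1 i 0 + E2 i 0.
  rewrite /E1 /E2 (h3 t (ltW t0)).
  rewrite (_ : \sum_(k < d) _ = ((sigma x - sigma 0) *m (B t w - B 0 w)) i 0); last first.
    by rewrite [RHS]mxE; apply: eq_bigr => k _; rewrite [in RHS]mxE [X in _ = (_ + X) * _]mxE.
  rewrite mulmxBl; move: (sigma x *m _) (sigma 0 *m _) => v1 v2.
  by rewrite !mxE; ring.
apply: le_trans (ler_normD _ _) _; rewrite normrN (splitr e) mulrDl lerD //.
  by apply: le_trans (mx_coord_le _ _ _) h1.
by apply: le_trans (mx_coord_le _ _ _) h2.
Qed.

Lemma solution_difference (S : 'M[R]_d) x y : (forall z, sigma z = S) ->
  {ae P, forall w, forall t, 0 <= t ->
    X x t w - X y t w = (x - y) + (drift_integral b (X x) t w - drift_integral b (X y) t w)}.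
Proof.
move=> sS.
have sol z : {ae P, forall w, forall t, 0 <= t -> X z t w = z + S *m B t w + drift_integral b (X z) t w}.
  have [_ _ _ [I ito eqX]] := X_solution z.
  have IS := @ito_close_constant _ _ _ _ P F F_filtration B B_brownian _ _ S ito (fun s w => sS _).
  by apply: filterS2 eqX IS => w eqX IS t t0; rewrite eqX // IS.
apply: filterS2 (sol x) (sol y) => w Hx Hy t t0; rewrite Hx // Hy //.
by apply/matrixP => i j; rewrite !mxE; ring.
Qed.

End deterministic_dependence.

Section zero_integral.
Context (R : realType).

Lemma continuous_integral0_eq0 (u : R -> R) : {within `[0, +oo[, continuous u} ->
  (forall t, 0 <= t -> \int[lebesgue_measure]_(s in `[0, t]) u s = 0) ->
  forall t, 0 < t -> u t = 0.
Proof.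
move=> cu int0 t t0.
have t1 : t < t + 1 by rewrite ltrDl.
have iu := continuous_integrable_itv (t + 1) cu.
have cut : {for t, continuous u}.
  have cu1 : {within `[0, t + 1], continuous u}.
    by apply: continuous_subspaceW cu => s /=; rewrite !in_itv /= andbT => /andP[].
  apply: within_continuous_continuous cu1 _; first exact: lt_trans t1.
  by rewrite in_itv /= t0 t1.
have [_ <-] := continuous_FTC1_closed t1 iu t0 cut.
(* For negative y the interval is empty, so the primitive is 0 on the whole line and its two-sided
   derivative at t can be taken. *)
have -> : (fun y => \int[lebesgue_measure]_(s in `[0, y]) u s) = cst 0.
  apply/funext => y /=; have [y0|y0] := leP 0 y; first exact: int0.
  by rewrite set_itv_ge ?Rintegral_set0 // bnd_simp -ltNge.
exact: derive1_cst.
Qed.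

End zero_integral.

(** * The drift when sigma is constant *)

Section drift.
Context (R : realType) (d : nat) (disp : measure_display) (T : measurableType disp)
  (P : probability T R) (F : R -> set (set T)).
Hypothesis F_filtration : filtration F.
Variable B : R -> T -> 'cV[R]_d.
Hypothesis B_brownian : brownian_motion P F B.
Variables (sigma : 'cV[R]_d -> 'M[R]_d) (b : 'cV[R]_d -> 'cV[R]_d).
Hypotheses (sigma_lipschitz : lipschitz sigma) (b_lipschitz : lipschitz b).
Variable X : 'cV[R]_d -> R -> T -> 'cV[R]_d.
Hypothesis X_solution : forall x, strong_solution P F B sigma b x (X x).
Variable S : 'M[R]_d.
Hypothesis sigmaE : forall z, sigma z = S.

Let cX x : continuous_paths (X x).
Proof. by case: (X_solution x). Qed.

Lemma drift_difference x y t w i : 0 <= t ->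
  (drift_integral b (X x) t w - drift_integral b (X y) t w) i 0 =
  \int[lebesgue_measure]_(s in `[0, t]) (b (X x s w) i 0 - b (X y s w) i 0).
Proof.
move=> t0; have cdr z : {within `[0, +oo[, continuous (fun s => b (X z s w) i 0)}.
  exact: (drift_path_continuous b_lipschitz X_solution).
have idr z := continuous_integrable_itv t (cdr z).
by rewrite RintegralB // !mxE.
Qed.

Lemma linear_drift_ode (alpha : 'cV[R]_d) (C : 'M[R]_d) x : (forall z, b z = alpha + C *m z) ->
  {ae P, forall w, ode_solution C x (fun t => X x t w - X 0 t w)}.
Proof.
move=> bE; have := solution_difference F_filtration B_brownian X_solution x 0 sigmaE.
apply: filterS => w Hw; split.
  by apply: within_continuousB; exact: cX.
move=> t t0; rewrite Hw // subr0; congr (_ + _).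
apply/matrixP => i j; rewrite (ord1 j) drift_difference // [RHS]mxE.
apply: eq_Rintegral => s _; rewrite !bE mulmxBr.
by rewrite !mxE opprD addrACA subrr add0r.
Qed.

Lemma solution_difference_expmx (alpha : 'cV[R]_d) (C : 'M[R]_d) x : (forall z, b z = alpha + C *m z) ->
  {ae P, forall w, forall t, 0 <= t -> X x t w = expmx (t *: C) *m x + X 0 t w}.
Proof.
move=> bE; apply: filterS (linear_drift_ode x bE) => w oD t t0.
(* Existence for the linear equation comes from the diffusion itself: one good sample path of the
   difference of two solutions, started at a basis vector and at 0. *)
have basis j : exists E, ode_solution C (delta_mx j 0) E.
  have [w' H] := ae_exists (linear_drift_ode (delta_mx j 0) bE).
  by exists (fun t => X (delta_mx j 0) t w' - X 0 t w').
by rewrite -(ode_solution_expmx basis oD t0) subrK.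
Qed.

Lemma drift_increment_deterministic (f : R -> 'cV[R]_d -> 'cV[R]_d) x i :
  {ae P, forall w, forall t, 0 <= t -> X x t w = f t x + X 0 t w} ->
  exists c : R -> R,
    {ae P, forall w, forall t, 0 < t -> b (X x t w) i 0 - b (X 0 t w) i 0 = c t}.
Proof.
move=> Xf.
have Hd := solution_difference F_filtration B_brownian X_solution x 0 sigmaE.
pose u w s := b (X x s w) i 0 - b (X 0 s w) i 0.
have good : {ae P, forall w, forall t, 0 <= t ->
    \int[lebesgue_measure]_(s in `[0, t]) u w s = (f t x - x) i 0}.
  apply: filterS2 Xf Hd => w Hf Hw t t0.
  rewrite /u -drift_difference //; have := Hw t t0; rewrite Hf // addrK subr0 => ->.
  by rewrite addrAC subrr add0r.
have cu w : {within `[0, +oo[, continuous (u w)}.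
  by apply: within_continuousB; exact: (drift_path_continuous b_lipschitz X_solution).
(* The deterministic function is the path of [u] at one fixed sample point w0: every good path is
   continuous and has the same integrals over all [0, t]. *)
have [w0 H0] := ae_exists good.
exists (u w0); apply: filterS good => w Hw t t0.
apply/eqP; rewrite -subr_eq0; apply/eqP.
apply: (@continuous_integral0_eq0 _ (fun s => u w s - u w0 s)) => //.
  by apply: within_continuousB; exact: cu.
move=> r r0; rewrite RintegralB //; try exact: continuous_integrable_itv.
by rewrite Hw // H0 // subrr.
Qed.

Lemma dot_le (g : 'I_d -> R) (h : 'cV[R]_d) :
  `|\sum_(j < d) g j * h j 0| <= (\sum_(j < d) `|g j|) * `|h|.
Proof.
apply: le_trans (ler_norm_sum _ _ _) _; rewrite mulr_suml.
by apply: ler_sum => j _; rewrite normrM ler_wpM2l // mx_coord_le.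
Qed.

Lemma drift_gradient_constant (f : R -> 'cV[R]_d -> 'cV[R]_d) x i : \det S != 0 ->
  (forall j z, derivable (fun y => b y i 0) z (delta_mx j 0)) ->
  (forall j : 'I_d, continuous (fun z => 'D_(delta_mx j 0) (fun y => b y i 0) z)) ->
  {ae P, forall w, forall t, 0 <= t -> X x t w = f t x + X 0 t w} ->
  forall j : 'I_d, 'D_(delta_mx j 0) (fun y => b y i 0) x = 'D_(delta_mx j 0) (fun y => b y i 0) 0.
Proof.
move=> Sdet db cdb Xf.
pose h y := b y i 0.
pose g (j : 'I_d) := 'D_(delta_mx j 0) h x.
pose g0 (j : 'I_d) := 'D_(delta_mx j 0) h 0.
(* The noise tests the gradient difference only through S, so the form shown to vanish is the row (g
   - g0) S; invertibility of S then gives g = g0. *)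
suff gS : forall k, \sum_(j < d) (g j - g0 j) * S j k = 0.
  have rS : (\row_j (g j - g0 j)) *m S = 0.
    by apply/matrixP => a k; rewrite !mxE -[RHS](gS k); apply: eq_bigr => j _; rewrite mxE.
  have uS : S \in unitmx by rewrite unitmxE unitfE.
  have r0 : \row_j (g j - g0 j) = 0 by rewrite -(mulmxK uS (\row_j _)) rS mul0mx.
  by move=> j; apply/eqP; rewrite -subr_eq0; apply/eqP; have := congr1 (fun r : 'rV_d => r 0 j) r0; rewrite !mxE.
have [c Hc] := drift_increment_deterministic i Xf.
apply: (brownian_form_eq0 F_filtration B_brownian).
move=> e p e0 p0.
have p4 : 0 < p / 4 by rewrite divr_gt0.
have [K K0 HK] := brownian_tight F_filtration B_brownian p4.
pose G := \sum_(j < d) `|g j|; pose G0 := \sum_(j < d) `|g0 j|.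
have Gge : 0 <= G by apply: sumr_ge0.
have G0ge : 0 <= G0 by apply: sumr_ge0.
have G1 : 0 < 4 * (G + G0 + 1) by rewrite mulr_gt0 // ltr_wpDl // addr_ge0.
(* Error budget in units of sqrt t: ep is the error of the path expansion, amplified by the
   gradients to at most e/4. The displacements have size at most a + ep, so the two Taylor errors,
   eta times the displacement, cost at most e/4 each. *)
pose ep := e / (4 * (G + G0 + 1)).
have ep0 : 0 < ep by rewrite divr_gt0.
pose a := d%:R * `|S| * K.
have a0 : 0 <= a by rewrite !mulr_ge0 // ltW.
have a1 : 0 < a + ep + 1 by rewrite ltr_wpDl // addr_ge0 // ltW.
pose eta := e / (4 * (a + ep + 1)).
have eta0 : 0 < eta by rewrite divr_gt0 // mulr_gt0.
have [r1 r10 Hr1] := first_order_expansion x db cdb eta0.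
have [r2 r20 Hr2] := first_order_expansion 0 db cdb eta0.
have [d1 d10 H1] := small_time_expansion F_filtration B_brownian sigma_lipschitz b_lipschitz
  (X_solution x) ep0 p4.
have [d2 d20 H2] := small_time_expansion F_filtration B_brownian sigma_lipschitz b_lipschitz
  (X_solution 0) ep0 p4.
pose rho := Num.min r1 r2.
have rho0 : 0 < rho by rewrite lt_min r10.
(* Below this time the displacements (a + ep) sqrt t stay in the ball where both Taylor expansions
   hold. *)
pose d3 := (rho / (a + ep + 1)) ^+ 2.
have d30 : 0 < d3 by rewrite exprn_gt0 // divr_gt0.
pose m := Num.min d1 (Num.min d2 d3).
have m0 : 0 < m by rewrite !lt_min d10 d20.
pose t := m / 2.
have t0 : 0 < t by rewrite divr_gt0.
have : t < m by rewrite /t; lra.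
rewrite !lt_min => /and3P[td1 td2 td3].
have s0 : 0 < Num.sqrt t by rewrite sqrtr_gt0.
have s_small : (a + ep) * Num.sqrt t <= rho.
  have : Num.sqrt t < rho / (a + ep + 1).
    have q0 : 0 < rho / (a + ep + 1) by rewrite divr_gt0.
    rewrite -(ltr_pXn2r (n := 2)) ?nnegrE //; try exact: ltW.
    by rewrite sqr_sqrtr // ltW.
  rewrite ltr_pdivlMr // => lt; apply: le_trans (ltW lt).
  by rewrite [leRHS]mulrC ler_wpM2r ?(ltW s0) // lerDl.
have [N1 [mN1 PN1 HN1]] := H1 t t0 td1.
have [N2 [mN2 PN2 HN2]] := H2 t t0 td2.
have [N3 [mN3 PN3 HN3]] := HK t t0.
have [N4 [mN4 PN4 HN4]] := ae_event p4 Hc.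
have [m12 P12] := event_union mN1 PN1 mN2 PN2 (lexx _).
have [m34 P34] := event_union mN3 PN3 mN4 PN4 (lexx _).
have [m1234 P1234] : measurable ((N1 `|` N2) `|` (N3 `|` N4)) /\
    (P ((N1 `|` N2) `|` (N3 `|` N4)) <= p%:E)%E.
  by apply: event_union m12 P12 m34 P34 _; lra.
exists t, (c t - (h x - h 0)), ((N1 `|` N2) `|` (N3 `|` N4)); split => // w.
move=> /not_orP[/not_orP[/HN1 h1 /HN2 h2] /not_orP[/HN3 h3 /HN4 h4]].
set dB := B t w - B 0 w in h1 h2 h3 *.
have hc := h4 t t0.
rewrite !sigmaE in h1 h2.
pose k1 := X x t w - x; pose k2 := X 0 t w - 0.
pose e1 := k1 - S *m dB; pose e2 := k2 - S *m dB.
have SdB : `|S *m dB| <= a * Num.sqrt t.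
  apply: le_trans (mx_norm_mulmx _ _) _.
  by rewrite /a -[_ * K * _]mulrA ler_wpM2l // mulr_ge0.
have k1le : `|k1| <= (a + ep) * Num.sqrt t.
  by rewrite -[k1](subrK (S *m dB)) addrC (le_trans (ler_normD _ _)) // mulrDl lerD.
have k2le : `|k2| <= (a + ep) * Num.sqrt t.
  by rewrite -[k2](subrK (S *m dB)) addrC (le_trans (ler_normD _ _)) // mulrDl lerD.
have k1r : `|k1| <= r1.
  by apply: le_trans k1le _; apply: le_trans s_small _; rewrite ge_min lexx.
have k2r : `|k2| <= r2.
  by apply: le_trans k2le _; apply: le_trans s_small _; rewrite ge_min lexx orbT.
pose R1 := h (x + k1) - h x - \sum_(j < d) g j * k1 j 0.
pose R2 := h (0 + k2) - h 0 - \sum_(j < d) g0 j * k2 j 0.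
have R1le : `|R1| <= eta * ((a + ep) * Num.sqrt t).
  by apply: le_trans (Hr1 k1 k1r) _; rewrite ler_wpM2l // ltW.
have R2le : `|R2| <= eta * ((a + ep) * Num.sqrt t).
  by apply: le_trans (Hr2 k2 k2r) _; rewrite ler_wpM2l // ltW.
have e1le : `|\sum_(j < d) g j * e1 j 0| <= G * (ep * Num.sqrt t).
  by apply: le_trans (dot_le _ _) _; rewrite ler_wpM2l.
have e2le : `|\sum_(j < d) g0 j * e2 j 0| <= G0 * (ep * Num.sqrt t).
  by apply: le_trans (dot_le _ _) _; rewrite ler_wpM2l.
have dotB (q : 'I_d -> R) (v1 v2 : 'cV[R]_d) :
    \sum_(j < d) q j * (v1 - v2) j 0 = \sum_(j < d) q j * v1 j 0 - \sum_(j < d) q j * v2 j 0.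
  by rewrite -sumrB; apply: eq_bigr => j _; rewrite -mulrBr; congr (_ * _); rewrite !mxE.
(* Writing each displacement as S dB plus its error and each drift increment as gradient part plus
   Taylor error leaves exactly these four error terms. *)
have -> : \sum_(l < d) (\sum_(j < d) (g j - g0 j) * S j l) * dB l 0 - (c t - (h x - h 0)) =
    - R1 + R2 - \sum_(j < d) g j * e1 j 0 + \sum_(j < d) g0 j * e2 j 0.
  have -> : \sum_(l < d) (\sum_(j < d) (g j - g0 j) * S j l) * dB l 0 =
      \sum_(j < d) g j * (S *m dB) j 0 - \sum_(j < d) g0 j * (S *m dB) j 0.
    rewrite -sumrB; under eq_bigr do rewrite mulr_suml.
    rewrite exchange_big /=; apply: eq_bigr => j _.
    by rewrite -mulrBl mxE mulr_sumr; apply: eq_bigr => l _; rewrite mulrA.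
  rewrite /R1 /R2 /e1 /e2 !dotB -hc /h /k1 /k2.
  rewrite [x + _]addrC subrK [0 + _]addrC subrK.
  ring.
have total : 2 * (eta * (a + ep)) + (G + G0) * ep <= e.
  have hA : eta * (a + ep) <= e / 4.
    rewrite /eta mulrAC ler_pdivrMr ?mulr_gt0 //.
    have -> : e / 4 * (4 * (a + ep + 1)) = e * (a + ep) + e by field.
    by rewrite lerDl ltW.
  have hB : (G + G0) * ep <= e / 4.
    rewrite /ep mulrA ler_pdivrMr //.
    have -> : e / 4 * (4 * (G + G0 + 1)) = (G + G0) * e + e by field.
    by rewrite lerDl ltW.
  by move: hA hB; move: (eta * _) (_ * ep) => ? ? ? ?; lra.
apply: le_trans (ler_normD _ _) _; apply: le_trans (lerD (ler_normB _ _) (lexx _)) _.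
apply: le_trans (lerD (lerD (ler_normD _ _) (lexx _)) (lexx _)) _.
rewrite normrN; apply: le_trans (lerD (lerD (lerD R1le R2le) e1le) e2le) _.
apply: (@le_trans _ _ ((2 * (eta * (a + ep)) + (G + G0) * ep) * Num.sqrt t)).
  by rewrite le_eqVlt; apply/orP; left; apply/eqP; ring.
by rewrite ler_wpM2r // ltW.
Qed.

End drift.

Theorem theorem2p3 (R : realType) (d : nat) (d_gt0 : (0 < d)%N)
    (disp : measure_display) (T : measurableType disp) (P : probability T R)
    (P_complete : measure_is_complete P)
    (F : R -> set (set T)) (F_filtration : filtration F)
    (F_usual : usual_conditions P F)
    (B : R -> T -> 'cV[R]_d) (B_brownian : brownian_motion P F B)
    (sigma : 'cV[R]_d -> 'M[R]_d) (sigma_lipschitz : lipschitz sigma)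
    (b : 'cV[R]_d -> 'cV[R]_d) (b_lipschitz : lipschitz b)
    (f : R -> 'cV[R]_d -> 'cV[R]_d)
    (X : 'cV[R]_d -> R -> T -> 'cV[R]_d)
    (X_solution : forall x, strong_solution P F B sigma b x (X x))
    (sigma_nondegenerate : exists x, \det (sigma x) != 0)
    (b_C2 : forall i : 'I_d, class_C 2 (fun x => b x i 0))
    (f_derivative : forall x, exists2 g : R -> 'cV[R]_d,
       forall t : R, 0 <= t -> is_time_derivative (f ^~ x) t (g t)
       & locally_bounded_variation g) :
  (forall x, {ae P, forall w, forall t : R, 0 <= t ->
     X x t w = f t x + X 0 t w})
  <->
  ((exists S : 'M[R]_d, \det S != 0 /\ forall x, sigma x = S) /\
   (exists (alpha : 'cV[R]_d) (C : 'M[R]_d),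
      (forall x, b x = alpha + C *m x) /\
      (forall (t : R) x, 0 <= t -> f t x = expmx (t *: C) *m x))).
Proof.
split=> [Xf|[[S [_ sigmaE]] [alpha [C [bE fE]]]] x]; last first.
  apply: filterS (solution_difference_expmx F_filtration B_brownian b_lipschitz X_solution sigmaE x bE).
  by move=> w Hw t t0; rewrite fE // Hw.
have sigmaE z : sigma z = sigma 0.
  exact: (sigma_constant F_filtration B_brownian sigma_lipschitz b_lipschitz X_solution (Xf z)).
have det0 : \det (sigma 0) != 0.
  by have [x] := sigma_nondegenerate; rewrite sigmaE.
split; first by exists (sigma 0).
have db i j z : derivable (fun y => b y i 0) z (delta_mx j 0).
  by have [_ /(_ j)[]] := b_C2 i.
have cdb i (j : 'I_d) : continuous (fun z => 'D_(delta_mx j 0) (fun y => b y i 0) z).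
  by have [_ /(_ j)[_ []]] := b_C2 i.
have grad i x := drift_gradient_constant F_filtration B_brownian sigma_lipschitz b_lipschitz
  X_solution sigmaE det0 (db i) (cdb i) (Xf x).
pose C : 'M[R]_d := \matrix_(i, j) 'D_(delta_mx j 0) (fun y => b y i 0) 0.
(* The mean value formula between 0 and x evaluates the partial derivatives at unknown points, but
   they are the same at every point, so it is exact with matrix C. *)
have bE x : b x = b 0 + C *m x.
  apply/matrixP => i k; rewrite (ord1 k) !mxE.
  have [xi [_ E]] := multivariate_MVT 0 x (db i).
  rewrite -[x in LHS]add0r -[LHS](subrK (b 0 i 0)) addrC E; congr (_ + _).
  by apply: eq_bigr => j _; rewrite mxE grad.
exists (b 0), C; split => // t x t0.
(* Both representations of X^x hold almost surely, so a single sample point satisfies both, and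
   cancelling X^0 there identifies the deterministic f(t, x). *)
have [w [Hw1 Hw2]] : exists w, (forall t, 0 <= t -> X x t w = f t x + X 0 t w) /\
    (forall t, 0 <= t -> X x t w = expmx (t *: C) *m x + X 0 t w).
  apply: (@ae_exists _ _ _ P); apply: filterS2 (Xf x)
    (solution_difference_expmx F_filtration B_brownian b_lipschitz X_solution sigmaE x bE).
  by move=> w H1 H2.
by apply: (addIr (X 0 t w)); rewrite -Hw1 // Hw2.
Qed.
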